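(* There exist universal constants $C_1,C_2>0$ such that the following holds. Let $0<\alpha<1/2$ and consider the product space $(\{-1,1\}^n,\nu_\alpha^{\otimes n})$. For any $n\ge 1$, for any set $A\subset\{-1,1\}^n$, and for any $\eta\in(0,1)$, $$\mathrm{VAR}(A,\eta)\ \le\ C_1\cdot\Big(\sum_{i=1}^n I_i^h(A)^2\Big)^{C_2\rho^2},$$ where $h(t)=\phi(\Phi^{-1}(t))$ and $\rho=\rho(\eta,\alpha)\in(0,1)$ is determined by the relation $$\eta=\frac{\mathbb{P}[W_1<\Phi^{-1}(\alpha),\ W_1^\rho>\Phi^{-1}(\alpha)]}{\alpha(1-\alpha)},$$ with $(W_1,W_1^\rho)$ a bivariate normal random vector with mean zero, unit variances and correlation $\sqrt{1-\rho^2}$.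
   Context: $\nu_\alpha=\alpha\delta_1+(1-\alpha)\delta_{-1}$ on $\{-1,1\}$. $\phi$ and $\Phi$ are the density and distribution function of the standard Gaussian measure on $\mathbb{R}$; $h(t)=\phi(\Phi^{-1}(t))$ for $t\in(0,1)$ and $h(0)=h(1)=0$. For $A\subseteq\{-1,1\}^n$, $1\le i\le n$ and $x\in\{-1,1\}^n$, the fiber is $A_i^x=\{y\in\{-1,1\}:(x_1,\dots,x_{i-1},y,x_{i+1},\dots,x_n)\in A\}$. The $h$-influence of the $i$-th coordinate is $I_i^h(A):=\mathbb{E}[h(\nu_\alpha(A_i^x))]$, where $x$ is distributed according to $\nu_\alpha^{\otimes n}$. Noise: let $X=(X_1,\dots,X_n)$ have law $\nu_\alpha^{\otimes n}$, let $X'$ be an i.i.d. copy of $X$, and let $X^\eta$ be the $(1-\eta)$-correlated copy of $X$: independently for distinct $j$, $X_j^\eta=X_j$ with probability $1-\eta$ and $X_j^\eta=X_j'$ with probability $\eta$. Then $\mathrm{VAR}(A,\eta)=\mathbb{E}[\mathbf{1}_A(X)\mathbf{1}_A(X^\eta)]-\nu_\alpha^{\otimes n}(A)^2$. *)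

(* Defs.v *)
From HB Require Import structures.
From mathcomp Require Import all_boot all_order all_algebra.
From mathcomp Require Import all_classical all_reals all_analysis.

Set Implicit Arguments.
Unset Strict Implicit.
Unset Printing Implicit Defensive.

Import Order.TTheory GRing.Theory Num.Theory.
Import numFieldNormedType.Exports.

Local Open Scope classical_set_scope.
Local Open Scope ring_scope.

Section gaussian.
Context {R : realType}.

Definition gauss_pdf (x : R) : R := normal_pdf 0 1 x.

Definition gauss_cdf (x : R) : R := fine (normal_prob 0 1 `]-oo, x]).

(* The default value 0 is only taken outside ]0, 1[, where no preimage exists. *)
Definition gauss_quantile (t : R) : R := xget 0 [set x | gauss_cdf x = t].

Definition gauss_h (t : R) : R :=
  if 0 < t < 1 then gauss_pdf (gauss_quantile t) else 0.

(* Joint density of a centered bivariate normal vector with unit variances and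
   correlation r; meaningful only for -1 < r < 1. *)
Definition binormal_pdf (r : R) (w : R * R) : R :=
  (2 * pi * Num.sqrt (1 - r ^+ 2))^-1 *
  expR (- (w.1 ^+ 2 - 2 * r * w.1 * w.2 + w.2 ^+ 2) / (2 * (1 - r ^+ 2))).

Definition binormal_prob (r : R) (V : set (R * R)) : \bar R :=
  (\int[lebesgue_measure \x lebesgue_measure]_(w in V) (binormal_pdf r w)%:E)%E.

Definition noise_param (alpha eta rho : R) : Prop :=
  0 < rho < 1 /\
  eta = fine (binormal_prob (Num.sqrt (1 - rho ^+ 2))
                [set w | w.1 < gauss_quantile alpha /\
                         w.2 > gauss_quantile alpha])
        / (alpha * (1 - alpha)).

End gaussian.

(* {-1, 1} is encoded by bool, with true standing for 1 and false for -1, so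
   that nu_alpha has mass function bernoulli_pmf alpha. *)
Definition cube (n : nat) := {ffun 'I_n -> bool}.

Section cube.
Context {R : realType} (n : nat).
Implicit Types (alpha eta p : R) (A : {set cube n}) (x y : cube n).

Definition nu alpha (B : {set bool}) : R := \sum_(b in B) bernoulli_pmf alpha b.

Definition cube_pmf p x : R := \prod_(i < n) bernoulli_pmf p (x i).

Definition nu_prod alpha A : R := \sum_(x in A) cube_pmf alpha x.

Definition cube_expect p (f : cube n -> R) : R :=
  \sum_(x : cube n) cube_pmf p x * f x.

Definition fiber A (i : 'I_n) x : {set bool} :=
  [set b : bool | [ffun j => if j == i then b else x j] \in A]%SET.

Definition h_influence (h : R -> R) alpha A (i : 'I_n) : R :=
  cube_expect alpha (fun x => h (nu alpha (fiber A i x))).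

(* s marks the coordinates taken from the independent copy x'. *)
Definition resample (s x x' : cube n) : cube n :=
  [ffun j => if s j then x' j else x j].

(* X, X' have law nu_alpha^n, and the set s of resampled coordinates is
   independent of them, each coordinate being in s with probability eta. *)
Definition VAR alpha A eta : R :=
  cube_expect alpha (fun x =>
    cube_expect alpha (fun x' =>
      cube_expect eta (fun s =>
        (x \in A)%:R * (resample s x x' \in A)%:R)))
  - nu_prod alpha A ^+ 2.

End cube.

(* Main.v *)
Require Import Defs.
From HB Require Import structures.
From mathcomp Require Import all_boot all_order all_algebra.
From mathcomp Require Import all_classical all_reals all_analysis.
From mathcomp Require Import measurable_realfun ring lra.

Set Implicit Arguments.
Unset Strict Implicit.
Unset Printing Implicit Defensive.

Import Order.TTheory GRing.Theory Num.Theory.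
Import numFieldNormedType.Exports.

Local Open Scope ring_scope.

(** Write [v = alpha * (1 - alpha)], [d = 1 - eta], and let [T_d] be the noise
operator that keeps each coordinate with probability [d] and resamples it
otherwise.  The proof has a discrete half and a Gaussian half, joined by the
inequality [d <= v `^ (c * rho ^+ 2)] for an absolute constant [c].

On the cube, expand the indicator [f] of [A] in products of centered bits.  The
variance [VAR] is the sum over [S <> 0] of [d ^+ |S| * c_S], where the [c_S] are
nonnegative of total at most 1 (lemma [VAR_energy]).  The function
[t |-> t `^ l] being concave, passing from the noise [d] to [d `^ l] raises the
bound to the power [l] (lemma [energy_powR]); hence one estimate at the single
noise level [d = v ^+ 4] controls all the others.  For this level, let [D_i f]
be the part of [f] that depends on the coordinate [i].  Each [S <> 0] contains
some [i], so the energy at [v ^+ 4] is at most the sum over [i] of the square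
norms of [T_v (T_v (D_i f))].  Since [T_v] is a contraction from L^2 to L^4
(lemma [noise_hyper]), duality and interpolation bound each of these by
the product of the L^1 and L^2 norms of [T_v (D_i f)] (lemma [noise_L1_L2]).
The squares of those L^2 norms sum to at most 1, because [k * v ^+ (2 * k)] is
at most 1, and the L^1 norm of [D_i f] is at most twice the h-influence, because
[h] is at least [v] at [alpha] and at [1 - alpha].  Cauchy-Schwarz over [i]
then yields the square root of the sum of the squared influences.

On the Gaussian side, put [a = Phi^-1(alpha) < 0] and, for [rho = sin theta],
[x = tan (theta / 2)], so that [rho = 2 x / (1 + x^2)] and the correlation is
[(1 - x^2) / (1 + x^2)].  The key identity is
  [P(W < a, W' > a) = \int_0^x 2 phi(a) phi(a z) / (1 + z^2) dz].
To obtain it, condition on [W = y], write the conditional probability as a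
Gaussian tail beginning at a threshold that moves with [1 / x], express that tail
as the integral of its derivative in [1 / x], exchange the two integrals, and
note that the remaining integral in [y] is elementary (lemmas [tail_threshold],
[integral_quadrant_rate_inv], [quadrant_rate_invE]).  At [x = 1] the coordinates are
independent and the integral is [v].  Thus [eta * v] is a strictly increasing
continuous function of [x] running from 0 to [v], which gives existence and
uniqueness of [rho]; and the density decreases, and a shift by [x] multiplies
it by at most [exp (- a^2 x^2 / 2)], which gives [1 - eta <= 1 - x] and
[1 - eta <= exp (- a^2 x^2 / 2)].  Since [v >= phi(a)^2 = exp (- a^2) / (2 pi)],
these two bounds combine into [1 - eta <= v `^ (rho^2 / 24)]. *)

(** * Two inequalities for finite weighted sums *)

Section sums.
Context {R : realType}.

Lemma cauchy_schwarz_sum (I : finType) (w a b : I -> R) :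
  (forall i, 0 <= w i) ->
  (\sum_i w i * (a i * b i)) ^+ 2 <=
  (\sum_i w i * a i ^+ 2) * (\sum_i w i * b i ^+ 2).
Proof.
move=> w0; set C := \sum_i _; set A := \sum_i _; set B := \sum_i _.
have E u u' : \sum_i \sum_j (w i * u i) * (w j * u' j) =
    (\sum_i w i * u i) * (\sum_i w i * u' i).
  by rewrite big_distrl; apply: eq_bigr => i _; rewrite big_distrr.
(* the Lagrange identity: the difference is a sum of squares *)
suff : 0 <= A * B + B * A - 2 * (C * C) by rewrite expr2; lra.
rewrite -!E !mulr_sumr -sumrN -!big_split/=; apply: sumr_ge0 => i _.
rewrite !mulr_sumr -sumrN -!big_split/=; apply: sumr_ge0 => j _.
have -> : w i * a i ^+ 2 * (w j * b j ^+ 2) +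
    w i * b i ^+ 2 * (w j * a j ^+ 2) -
    2 * (w i * (a i * b i) * (w j * (a j * b j))) =
    w i * w j * (a i * b j - a j * b i) ^+ 2 by ring.
by rewrite mulr_ge0 ?sqr_ge0 ?mulr_ge0.
Qed.

(** Jensen's inequality for the concave map [t |-> t `^ l], in the form needed
for weights of total at most 1. *)
Lemma sum_powR_concave (I : finType) (w t : I -> R) (l : R) :
  (forall i, 0 <= w i) -> (forall i, 0 <= t i) -> \sum_i w i <= 1 ->
  0 < l <= 1 -> \sum_i w i * t i `^ l <= (\sum_i w i * t i) `^ l.
Proof.
move=> w0 t0 w1 /andP[l0]; rewrite le_eqVlt => /predU1P[->|l1].
  by rewrite powRr1 ?sumr_ge0// => [|i _]; [
    under eq_bigr do rewrite powRr1//|rewrite mulr_ge0].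
set m := \sum_i w i * t i.
have m0 : 0 <= m by apply: sumr_ge0 => i _; rewrite mulr_ge0.
have [m_eq0|mN0] := eqVneq m 0.
  rewrite big1 ?powR_ge0// => i _.
  have /eqP : w i * t i = 0.
    by apply: (psumr_eq0P _ m_eq0) => // j _; rewrite mulr_ge0.
  rewrite mulf_eq0 => /orP[/eqP->|/eqP->]; first by rewrite mul0r.
  by rewrite powR0 ?mulr0// gt_eqF.
(* Young's inequality, with equality when [t i] is the mean [m] *)
have young i : t i `^ l * m `^ (1 - l) <= l * t i + (1 - l) * m.
  have := @conjugate_powR R (t i `^ l) (m `^ (1 - l)) l^-1 (1 - l)^-1.
  rewrite !powR_ge0 !invrK -!powRrM !divff ?gt_eqF ?subr_gt0// !powRr1//.
  rewrite !invr_gt0 subr_gt0 l0 l1 addrC subrK => /(_ isT isT isT isT erefl).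
  by rewrite [t i * l]mulrC [m * _]mulrC.
have mp : 0 < m `^ (1 - l) by apply: powR_gt0; rewrite lt0r mN0.
rewrite -(ler_pM2r mp) -powRD; last by rewrite addrC subrK oner_eq0.
rewrite [l + _]addrC subrK powRr1// mulr_suml.
apply: (@le_trans _ _ (\sum_i w i * (l * t i + (1 - l) * m))).
  by apply: ler_sum => i _; rewrite -mulrA ler_wpM2l.
have -> : \sum_i w i * (l * t i + (1 - l) * m) =
    l * m + (1 - l) * m * \sum_i w i.
  rewrite /m !mulr_sumr -big_split/=; apply: eq_bigr => i _; ring.
have : (1 - l) * m * \sum_i w i <= (1 - l) * m.
  by rewrite ler_piMr// mulr_ge0// subr_ge0 ltW.
lra.
Qed.

End sums.

(** * Fourier analysis on the biased cube *)

Section bit.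
Context {R : realType} (p : R).
Local Notation mu := (bernoulli_pmf p).

Definition cbit (b : bool) : R := b%:R - p.
Definition bitvar : R := p * (1 - p).

Lemma sum_bit (F : bool -> R) :
  \sum_b mu b * F b = p * F true + (1 - p) * F false.
Proof. by rewrite big_bool. Qed.

Lemma sum_bit1 : \sum_b mu b = 1.
Proof. by rewrite big_bool/= addrC subrK. Qed.

Lemma sum_cbit : \sum_b mu b * cbit b = 0.
Proof. rewrite sum_bit /cbit/=; ring. Qed.

Lemma sum_cbit2 : \sum_b mu b * (cbit b * cbit b) = bitvar.
Proof. rewrite sum_bit /cbit /bitvar/=; ring. Qed.

End bit.

Section expect.
Context {R : realType} (n : nat) (p : R).
Implicit Types (x y z S : cube n) (f g : cube n -> R).
Local Notation mu := (bernoulli_pmf p).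
Local Notation E := (@cube_expect R n p).

Definition set_bit x (i : 'I_n) (b : bool) : cube n :=
  [ffun j => if j == i then b else x j].

Lemma cube_pmf_ge0 x : 0 <= p <= 1 -> 0 <= cube_pmf p x.
Proof. by move=> p01; apply: prodr_ge0 => i _; exact: bernoulli_pmf_ge0. Qed.

Lemma expect_prod (g : 'I_n -> bool -> R) :
  E (fun x => \prod_i g i (x i)) = \prod_i \sum_b mu b * g i b.
Proof.
by rewrite bigA_distr_bigA; apply: eq_bigr => x _; rewrite -big_split.
Qed.

Lemma eq_expect f g : f =1 g -> E f = E g.
Proof. by move=> fg; apply: eq_bigr => x _; rewrite fg. Qed.

Lemma expectD f g : E (fun x => f x + g x) = E f + E g.
Proof. by rewrite -big_split; apply: eq_bigr => x _; rewrite mulrDr. Qed.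

Lemma expectZ c f : E (fun x => c * f x) = c * E f.
Proof.
by rewrite /cube_expect mulr_sumr; apply: eq_bigr => x _; rewrite mulrCA.
Qed.

Lemma expect_sum (I : finType) (F : I -> cube n -> R) :
  E (fun x => \sum_i F i x) = \sum_i E (F i).
Proof.
by rewrite exchange_big; apply: eq_bigr => x _; rewrite mulr_sumr.
Qed.

Lemma expect1 : E (fun=> 1) = 1.
Proof.
have := expect_prod (fun _ _ => 1); under eq_expect do rewrite big1//.
by move=> ->; rewrite big1// => i _; under eq_bigr do rewrite mulr1; exact: sum_bit1.
Qed.

Lemma expect_cst c : E (fun=> c) = c.
Proof.
transitivity (E (fun=> c * 1)); last by rewrite expectZ expect1 mulr1.
by apply: eq_expect => x; rewrite mulr1.
Qed.

Lemma le_expect f g : 0 <= p <= 1 -> (forall x, f x <= g x) -> E f <= E g.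
Proof.
by move=> p01 fg; apply: ler_sum => x _; rewrite ler_wpM2l ?cube_pmf_ge0.
Qed.

Lemma expect_ge0 f : 0 <= p <= 1 -> (forall x, 0 <= f x) -> 0 <= E f.
Proof.
by move=> p01 f0; apply: sumr_ge0 => x _; rewrite mulr_ge0 ?cube_pmf_ge0.
Qed.

(** Resampling one coordinate preserves the product law: exchanging the old bit
with the fresh one is an involution that preserves the joint weight. *)
Lemma expect_set_bit (i : 'I_n) f :
  E f = E (fun x => \sum_b mu b * f (set_bit x i b)).
Proof.
rewrite /cube_expect.
under [RHS]eq_bigr do rewrite mulr_sumr.
rewrite pair_bigA/=.
pose h (u : cube n * bool) : cube n * bool := (set_bit u.1 i u.2, u.1 i).
have hK : involutive h.
  move=> [x b]; rewrite /h/= ffunE eqxx; congr pair.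
  by apply/ffunP => j; rewrite !ffunE; case: eqP => // ->.
rewrite (reindex_inj (can_inj hK))/=.
rewrite -(pair_bigA _ (fun x b => cube_pmf p (set_bit x i b) *
   (mu (x i) * f (set_bit (set_bit x i b) i (x i)))))/=.
apply: eq_bigr => x _; rewrite -[LHS]mul1r -{1}(sum_bit1 p) mulr_suml.
apply: eq_bigr => b _.
have -> : set_bit (set_bit x i b) i (x i) = x.
  by apply/ffunP => j; rewrite !ffunE; case: eqP => // ->.
rewrite mulrA mulrA; congr (_ * _).
rewrite /cube_pmf (bigD1 i)//= [in RHS](bigD1 i)//= !ffunE eqxx.
rewrite mulrCA [in RHS]mulrAC -[in RHS]mulrA mulrC -!mulrA; congr (_ * _).
rewrite mulrC; congr (_ * _).
by apply: eq_bigr => j ji; rewrite ffunE (negPf ji).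
Qed.

End expect.

Section fourier.
Context {R : realType} (n : nat) (p : R).
Hypothesis p01 : 0 < p < 1.
Implicit Types (x y z S : cube n) (f g : cube n -> R).
Local Notation mu := (bernoulli_pmf p).
Local Notation E := (@cube_expect R n p).
Local Notation v := (bitvar p).
Local Notation psi := (cbit p).

Lemma bitvar_gt0 : 0 < v.
Proof. by case/andP: p01 => ? ?; rewrite mulr_gt0// subr_gt0. Qed.

Definition level S : nat := (\sum_i S i)%N.

Lemma prod_level (d : R) S : \prod_i (if S i then d else 1) = d ^+ level S.
Proof. by rewrite expr_sum; apply: eq_bigr => i _; case: (S i). Qed.

(** A subset of the coordinates is encoded by its indicator, itself a point of
the cube, so that products over coordinates expand by distributivity. *)
Definition chi S x : R := \prod_i (if S i then psi (x i) else 1).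

Definition fhat f S : R := E (fun x => f x * chi S x).

(** With this normalisation [noise d] multiplies the coefficient of [S] by
[(d * v) ^+ level S]; it is the operator that keeps each coordinate with
probability [d * v].  Square roots of [v] never appear because the characters
are not normalised.  In particular [noise v^-1] is the identity and [noise 1]
keeps coordinates with probability [v]. *)
Definition noise_kernel (d : R) x z : R := \prod_i (1 + d * (psi (x i) * psi (z i))).

Definition noise (d : R) f x : R := E (fun z => noise_kernel d x z * f z).

Lemma noise_kernelE d x z :
  noise_kernel d x z = \sum_S d ^+ level S * (chi S x * chi S z).
Proof.
rewrite /noise_kernel.
under eq_bigr => i _.
  rewrite addrC.
  rewrite (_ : _ + 1 = \sum_(b : bool)
    (if b then d else 1) * ((if b then psi (x i) else 1) *
     (if b then psi (z i) else 1))); last by rewrite big_bool !mulr1.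
  over.
by rewrite bigA_distr_bigA; apply: eq_bigr => S _; rewrite !big_split prod_level.
Qed.

Lemma noiseE d f x : noise d f x = \sum_S d ^+ level S * fhat f S * chi S x.
Proof.
rewrite /noise.
transitivity (E (fun z => \sum_S d ^+ level S * chi S x * (f z * chi S z))).
  apply: eq_expect => z; rewrite noise_kernelE mulr_suml.
  apply: eq_bigr => S _ /=; ring.
rewrite expect_sum; apply: eq_bigr => S _; rewrite expectZ -/(fhat f S); ring.
Qed.

Lemma chi_orth S T : E (fun x => chi S x * chi T x) = (S == T)%:R * v ^+ level S.
Proof.
under eq_expect do rewrite -big_split.
rewrite (expect_prod p (fun i b => (if S i then psi b else 1) *
  (if T i then psi b else 1))).
have [->|ST] := eqVneq S T.
  rewrite mul1r -prod_level; apply: eq_bigr => i _; case: (T i).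
    exact: sum_cbit2.
  by under eq_bigr do rewrite !mulr1; exact: sum_bit1.
have /existsP[i Si] : [exists i, S i != T i].
  by apply: contraNT ST => /existsPn H; apply/eqP/ffunP => i; apply/eqP/negPn.
rewrite (bigD1 i)//= [X in X * _](_ : _ = 0) ?mul0r//.
rewrite -[RHS](sum_cbit p); apply: eq_bigr => b _; congr (_ * _).
by case: (S i) (T i) Si => [] [] // _; rewrite ?mulr1 ?mul1r.
Qed.

Lemma fhat_noise d f S : fhat (noise d f) S = (d * v) ^+ level S * fhat f S.
Proof.
rewrite /fhat.
transitivity (E (fun x => \sum_T d ^+ level T * fhat f T * (chi T x * chi S x))).
  apply: eq_expect => x; rewrite noiseE mulr_suml.
  by apply: eq_bigr => T _; rewrite mulrA.
rewrite expect_sum (bigD1 S)//= big1 ?addr0.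
  by rewrite expectZ chi_orth eqxx mul1r [(d * v) ^+ _]exprMn /fhat mulrAC.
by move=> T TS; rewrite expectZ chi_orth (negPf TS) mul0r mulr0.
Qed.

Lemma expect_noise d f g :
  E (fun x => g x * noise d f x) = \sum_S d ^+ level S * (fhat f S * fhat g S).
Proof.
transitivity (E (fun x => \sum_S d ^+ level S * fhat f S * (g x * chi S x))).
  apply: eq_expect => x; rewrite noiseE mulr_sumr; apply: eq_bigr => S _ /=; ring.
rewrite expect_sum; apply: eq_bigr => S _; rewrite expectZ -/(fhat g S); ring.
Qed.

(** The law of a bit after noise, as a density with respect to [mu]; this is
where [noise] meets its probabilistic description. *)
Lemma bit_noise (d : R) b c :
  d * (b == c)%:R + (1 - d) * mu c = mu c * (1 + d / v * (psi b * psi c)).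
Proof.
have /andP[p0 p1] := p01.
have pN0 : p != 0 by rewrite gt_eqF.
have qN0 : 1 - p != 0 by rewrite subr_eq0 gt_eqF.
by rewrite /bitvar /cbit; case: b c => [] [] /=; field; rewrite pN0 qN0.
Qed.

Lemma noise_id f : noise v^-1 f =1 f.
Proof.
move=> x; rewrite /noise /cube_expect (bigD1 x)//= big1 ?addr0.
  rewrite mulrA -big_split/= big1 ?mul1r// => i _.
  have := bit_noise 1 (x i) (x i).
  by rewrite eqxx subrr mul0r addr0 !mul1r => <-.
move=> z zx; rewrite mulrA -big_split/=.
have /existsP[i zi] : [exists i, z i != x i].
  by apply: contraNT zx => /existsPn H; apply/eqP/ffunP => i; apply/eqP/negPn.
rewrite (bigD1 i)//=; have := bit_noise 1 (x i) (z i).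
by rewrite subrr mul0r addr0 !mul1r eq_sym (negPf zi) => <-; rewrite !mul0r.
Qed.

(** Completeness of the characters is the fact that [noise v^-1] is the
identity. *)
Lemma parseval f g :
  E (fun x => f x * g x) = \sum_S (fhat f S * fhat g S) / v ^+ level S.
Proof.
under eq_expect do rewrite mulrC -[f _]noise_id.
by rewrite expect_noise; apply: eq_bigr => S _; rewrite mulrC exprVn.
Qed.

(** Both laws are products over the coordinates, so the density of the resampled
point factors into the one-bit densities of [bit_noise]. *)
Lemma expect_resample (d : R) f x :
  E (fun x' => cube_expect (1 - d) (fun s => f (resample s x x'))) =
  noise (d / v) f x.
Proof.
transitivity (\sum_(x' : cube n) \sum_(s : cube n) \sum_z
    (cube_pmf p x' * cube_pmf (1 - d) s) * ((resample s x x' == z)%:R * f z)).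
  apply: eq_bigr => x' _; rewrite mulr_sumr; apply: eq_bigr => s _.
  rewrite (bigD1 (resample s x x'))//= eqxx mul1r big1 ?addr0 ?mulrA//.
  by move=> z; rewrite eq_sym => /negPf ->; rewrite mul0r mulr0.
under eq_bigr do rewrite exchange_big/=.
rewrite exchange_big/=; apply: eq_bigr => z _.
transitivity (f z * \prod_i \sum_b \sum_c mu b * (bernoulli_pmf (1 - d) c *
   ((if c then b else x i) == z i)%:R)).
  rewrite bigA_distr_bigA mulr_sumr; apply: eq_bigr => x' _.
  rewrite bigA_distr_bigA mulr_sumr; apply: eq_bigr => s _.
  rewrite !big_split/=.
  have -> : \prod_i ((if s i then x' i else x i) == z i)%:R =
      (resample s x x' == z)%:R :> R.
    have [<-|N] := eqVneq (resample s x x') z.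
      by rewrite big1// => i _; rewrite ffunE eqxx.
    have /existsP[i zi] : [exists i, resample s x x' i != z i].
      by apply: contraNT N => /existsPn H; apply/eqP/ffunP => i; apply/eqP/negPn.
    by rewrite (bigD1 i)//=; move: zi; rewrite ffunE => /negPf ->; rewrite mul0r.
  rewrite -/(cube_pmf p x') -/(cube_pmf (1 - d) s); ring.
rewrite mulrA mulrC; congr (_ * _); rewrite -big_split/=.
apply: eq_bigr => i _; rewrite -bit_noise.
by rewrite !big_bool/=; case: (x i) (z i) => [] [] /=; ring.
Qed.

End fourier.

(** * Hypercontractivity from L^2 to L^4 *)

Section hypercontractive.
Context {R : realType} (p : R).
Hypothesis p01 : 0 < p < 1.
Local Notation mu := (bernoulli_pmf p).
Local Notation v := (bitvar p).
Local Notation psi := (cbit p).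

Lemma bitvar_le4 : v <= 1 / 4.
Proof.
rewrite /bitvar; have : 0 <= (p - 1 / 2) ^+ 2 by exact: sqr_ge0.
have -> : (p - 1 / 2) ^+ 2 = p ^+ 2 - p + 1 / 4 by field.
rewrite expr2; lra.
Qed.

(** Prepending a bit, for the induction on the number of coordinates. *)
Definition scons n (b : bool) (y : cube n) : cube n.+1 :=
  [ffun i => if unlift ord0 i is Some j then y j else b].

Lemma scons0 n b (y : cube n) : scons b y ord0 = b.
Proof. by rewrite ffunE unlift_none. Qed.

Lemma sconsS n b (y : cube n) j : scons b y (lift ord0 j) = y j.
Proof. by rewrite ffunE liftK. Qed.

Lemma expect_scons n (f : cube n.+1 -> R) :
  cube_expect p f = \sum_b mu b * cube_expect p (fun y => f (scons b y)).
Proof.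
pose h (x : cube n.+1) : bool * cube n := (x ord0, [ffun j => x (lift ord0 j)]).
have scK : cancel (fun u => scons u.1 u.2) h.
  move=> [b y]; rewrite /h scons0; congr pair.
  by apply/ffunP => j; rewrite ffunE sconsS.
have hK : cancel h (fun u => scons u.1 u.2).
  move=> x; apply/ffunP => i; rewrite /h !ffunE/=.
  by case: unliftP => [j ->|->]; rewrite ?ffunE.
rewrite /cube_expect (reindex (fun u : bool * cube n => scons u.1 u.2))/=.
  under [RHS]eq_bigr do rewrite mulr_sumr.
  rewrite pair_bigA/=; apply: eq_bigr => -[b y] _ /=.
  rewrite mulrA; congr (_ * _).
  rewrite /cube_pmf big_ord_recl scons0; congr (_ * _).
  by apply: eq_bigr => i _; rewrite sconsS.
by exists h => u _; [exact: scK | exact: hK].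
Qed.

Lemma noise_scons n (d : R) (f : cube n.+1 -> R) b (y : cube n) :
  noise p d f (scons b y) =
  \sum_c mu c * ((1 + d * (psi b * psi c)) *
                 noise p d (fun z => f (scons c z)) y).
Proof.
rewrite /noise expect_scons; apply: eq_bigr => c _; congr (_ * _).
rewrite -expectZ; apply: eq_expect => z.
rewrite /noise_kernel big_ord_recl !scons0 -mulrA; congr (_ * (_ * _)).
by apply: eq_bigr => i _; rewrite !sconsS.
Qed.

Lemma noise_lin n (d c : R) (f g : cube n -> R) x :
  noise p d (fun z => f z + c * g z) x = noise p d f x + c * noise p d g x.
Proof.
rewrite /noise -expectZ -expectD; apply: eq_expect => z; ring.
Qed.

(** The Bonami argument.  Write [f = f0 + psi * f1] along the first coordinate;
the noise sends it to [F0 + v * psi * F1].  In the fourth moment the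
linear term vanishes, the cubic one is absorbed in its neighbours, and the
factors [v] outweigh the large fourth moment of a biased bit.  The mixed term
is bounded with Cauchy-Schwarz and the induction hypothesis. *)
Lemma noise_hyper n (f : cube n -> R) :
  cube_expect p (fun x => noise p 1 f x ^+ 4) <=
  cube_expect p (fun x => f x ^+ 2) ^+ 2.
Proof.
have p01' : 0 <= p <= 1 by case/andP: p01 => /ltW -> /ltW ->.
have v0 := bitvar_gt0 p01; have v4 := bitvar_le4.
elim: n f => [|n IH] f.
  have E0 (g : cube 0 -> R) : cube_expect p g = g [ffun=> true].
    have all x : x = [ffun=> true] :> cube 0 by apply/ffunP => -[].
    transitivity (@cube_expect R 0 p (fun=> g [ffun=> true])).
      by apply: eq_expect => x; rewrite (all x).
    exact: expect_cst.
  rewrite !E0 /noise E0 /noise_kernel big_ord0 mul1r -exprM.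
  exact: lexx.
pose f0 y := \sum_b mu b * f (scons b y).
pose f1 y := f (scons true y) - f (scons false y).
have fE b y : f (scons b y) = f0 y + psi b * f1 y.
  rewrite /f0 sum_bit /f1 /cbit; case: b => /=; ring.
have nE b y : noise p 1 f (scons b y) =
    noise p 1 f0 y + (v * psi b) * noise p 1 f1 y.
  rewrite noise_scons.
  have lin c : noise p 1 (fun z => f (scons c z)) y =
      noise p 1 f0 y + psi c * noise p 1 f1 y.
    by rewrite -noise_lin; congr (noise p 1 _ y); apply/funext => z.
  under eq_bigr do rewrite lin.
  rewrite sum_bit /cbit /bitvar; case: b => /=; ring.
set F0 := noise p 1 f0 in nE *; set F1 := noise p 1 f1 in nE *.
pose E := @cube_expect R n p.
have E2 : cube_expect p (fun x => f x ^+ 2) =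
    E (fun y => f0 y ^+ 2) + v * E (fun y => f1 y ^+ 2).
  rewrite expect_scons -expectZ -expectD big_bool/= -!expectZ -expectD.
  apply: eq_expect => y; rewrite !fE /cbit /bitvar /=; ring.
have E4 : cube_expect p (fun x => noise p 1 f x ^+ 4) <=
    E (fun y => F0 y ^+ 4) + (2 * v * E (fun y => F0 y ^+ 2 * F1 y ^+ 2) +
    v ^+ 2 * E (fun y => F1 y ^+ 4)).
  rewrite expect_scons -!expectZ -!expectD big_bool/= -!expectZ -expectD.
  apply: le_expect => // y; rewrite !nE.
  set a := F0 y; set b := F1 y.
  have -> : p * (a + v * psi true * b) ^+ 4 +
      (1 - p) * (a + v * psi false * b) ^+ 4 =
      a ^+ 4 + 6 * v ^+ 3 * (a ^+ 2 * b ^+ 2) +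
      4 * v ^+ 4 * (1 - 2 * p) * (a * b ^+ 3) + v ^+ 5 * (1 - 3 * v) * b ^+ 4.
    rewrite /cbit /bitvar/=; ring.
  have ab0 : 0 <= a ^+ 2 * b ^+ 2 by rewrite mulr_ge0 ?sqr_ge0.
  have b0 : 0 <= b ^+ 4 by rewrite -[4%N]/(2 * 2)%N exprM sqr_ge0.
  have v3 : v ^+ 3 <= v / 16.
    rewrite (_ : v ^+ 3 = v * (v * v)); last by ring.
    by rewrite ler_pM2l//; nra.
  have v5 : v ^+ 4 <= v ^+ 2 / 16.
    rewrite (_ : v ^+ 4 = v ^+ 2 * (v * v)); last by ring.
    by rewrite ler_pM2l ?exprn_gt0//; nra.
  have v2 : v ^+ 2 <= v / 4 by rewrite expr2; nra.
  have vv0 : 0 <= v ^+ 4 by rewrite exprn_ge0// ltW.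
  have H1 : (1 - 2 * p) * (a * b ^+ 3) <= (a ^+ 2 * b ^+ 2 + b ^+ 4) / 2.
    have [q0 q1] : -1 <= 1 - 2 * p /\ 1 - 2 * p <= 1.
      by case/andP: p01' => ? ?; split; lra.
    have s1 : 0 <= b ^+ 2 * (a - b) ^+ 2 by rewrite mulr_ge0 ?sqr_ge0.
    have s2 : 0 <= b ^+ 2 * (a + b) ^+ 2 by rewrite mulr_ge0 ?sqr_ge0.
    have {}s1 : a * b ^+ 3 <= (a ^+ 2 * b ^+ 2 + b ^+ 4) / 2.
      have e : b ^+ 2 * (a - b) ^+ 2 =
          a ^+ 2 * b ^+ 2 + b ^+ 4 - 2 * (a * b ^+ 3) by ring.
      by rewrite e in s1; lra.
    have {}s2 : - (a * b ^+ 3) <= (a ^+ 2 * b ^+ 2 + b ^+ 4) / 2.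
      have e : b ^+ 2 * (a + b) ^+ 2 =
          a ^+ 2 * b ^+ 2 + b ^+ 4 + 2 * (a * b ^+ 3) by ring.
      by rewrite e in s2; lra.
    move: (a * b ^+ 3) s1 s2 => t s1 s2; nra.
  have H2 : 4 * v ^+ 4 * (1 - 2 * p) * (a * b ^+ 3) <=
      2 * v ^+ 4 * (a ^+ 2 * b ^+ 2 + b ^+ 4).
    rewrite -mulrA (_ : 2 * v ^+ 4 * _ = 4 * v ^+ 4 *
      ((a ^+ 2 * b ^+ 2 + b ^+ 4) / 2)); last by field.
    by rewrite ler_wpM2l// mulr_ge0.
  have H3 : v ^+ 5 * (1 - 3 * v) * b ^+ 4 <= v ^+ 4 * b ^+ 4.
    rewrite ler_wpM2r// exprS mulrC mulrA ler_piMl//; nra.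
  have H4 : 6 * v ^+ 3 * (a ^+ 2 * b ^+ 2) + 2 * v ^+ 4 * (a ^+ 2 * b ^+ 2) <=
      2 * v * (a ^+ 2 * b ^+ 2).
    by rewrite -mulrDl ler_wpM2r//; lra.
  have H5 : 3 * v ^+ 4 * b ^+ 4 <= v ^+ 2 * b ^+ 4.
    rewrite ler_wpM2r//; have := sqr_ge0 v; lra.
  lra.
apply: (le_trans E4).
have E2_ge0 (g : cube n -> R) : 0 <= E (fun y => g y ^+ 2).
  by apply: expect_ge0 => // y; exact: sqr_ge0.
set A0 := E (fun y => f0 y ^+ 2) in E2 *.
set A1 := E (fun y => f1 y ^+ 2) in E2 *.
have I0 : E (fun y => F0 y ^+ 4) <= A0 ^+ 2 := IH f0.
have I1 : E (fun y => F1 y ^+ 4) <= A1 ^+ 2 := IH f1.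
have A0_ge0 : 0 <= A0 by exact: E2_ge0.
have A1_ge0 : 0 <= A1 by exact: E2_ge0.
have I2 : E (fun y => F0 y ^+ 2 * F1 y ^+ 2) <= A0 * A1.
  rewrite -(@ler_pXn2r _ 2%N)// ?nnegrE ?mulr_ge0//; last first.
    by apply: expect_ge0 => // y; rewrite mulr_ge0 ?sqr_ge0.
  apply: le_trans.
    apply: (@cauchy_schwarz_sum R _ (cube_pmf p) (fun y => F0 y ^+ 2)
      (fun y => F1 y ^+ 2)) => x; exact: cube_pmf_ge0.
  rewrite exprMn; apply: ler_pM.
  - by apply: sumr_ge0 => x _; rewrite mulr_ge0 ?sqr_ge0 ?cube_pmf_ge0.
  - by apply: sumr_ge0 => x _; rewrite mulr_ge0 ?sqr_ge0 ?cube_pmf_ge0.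
  - by under eq_bigr do rewrite -exprM.
  - by under eq_bigr do rewrite -exprM.
rewrite E2 sqrrD -addrA lerD//.
have I2' : 2 * v * E (fun y => F0 y ^+ 2 * F1 y ^+ 2) <= 2 * v * (A0 * A1).
  by rewrite ler_wpM2l// mulr_ge0// ltW.
have I1' : v ^+ 2 * E (fun y => F1 y ^+ 4) <= v ^+ 2 * A1 ^+ 2.
  by rewrite ler_wpM2l// sqr_ge0.
have -> : A0 * (v * A1) *+ 2 = 2 * v * (A0 * A1) by ring.
by rewrite [(v * A1) ^+ 2]exprMn lerD.
Qed.

End hypercontractive.

(** * Influences bound the noise correlation *)

Section influences.
Context {R : realType} (n : nat) (p : R).
Hypothesis p01 : 0 < p < 1.
Implicit Types (x y z S : cube n) (f g : cube n -> R) (i : 'I_n).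
Local Notation mu := (bernoulli_pmf p).
Local Notation E := (@cube_expect R n p).
Local Notation v := (bitvar p).
Local Notation psi := (cbit p).
Local Notation fhat := (fhat p).
Local Notation noise := (noise p).

Let p01' : 0 <= p <= 1.
Proof. by case/andP: p01 => /ltW -> /ltW ->. Qed.

Let v_gt0 : 0 < v := bitvar_gt0 p01.

Let ev_gt0 k : 0 < v ^+ k.
Proof. by rewrite exprn_gt0. Qed.

(** The difference between [f] and its average over the coordinate [i]. *)
Definition fluct i f x : R :=
  psi (x i) * (f (set_bit x i true) - f (set_bit x i false)).

Lemma set_bit_set_bit x i b c : set_bit (set_bit x i b) i c = set_bit x i c.
Proof. by apply/ffunP => j; rewrite !ffunE; case: eqP. Qed.

Lemma fhat_fluct i f S : fhat (fluct i f) S = if S i then fhat f S else 0.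
Proof.
rewrite /fhat (expect_set_bit p i) [in RHS](expect_set_bit p i).
pose X x := \prod_(j | j != i) (if S j then psi (x j) else 1).
have chiE x b : chi p S (set_bit x i b) = (if S i then psi b else 1) * X x.
  rewrite /chi (bigD1 i)//= ffunE eqxx; congr (_ * _).
  by apply: eq_bigr => j ji; rewrite ffunE (negPf ji).
case: ifPn => Si.
  apply: eq_expect => x; rewrite !sum_bit !chiE /fluct !set_bit_set_bit !ffunE eqxx Si.
  rewrite /cbit /=; ring.
rewrite -[RHS](@expect_cst R n p 0); apply: eq_expect => x.
rewrite sum_bit !chiE /fluct !set_bit_set_bit !ffunE eqxx (negPf Si) /cbit /=; ring.
Qed.

Lemma expect_norm_fluct i f :
  E (fun x => `|fluct i f x|) =
  2 * v * E (fun x => `|f (set_bit x i true) - f (set_bit x i false)|).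
Proof.
case/andP: p01' => p0 p1.
rewrite (expect_set_bit p i) -expectZ; apply: eq_expect => x.
rewrite sum_bit /fluct !set_bit_set_bit !ffunE eqxx !normrM /cbit/=.
rewrite [`|1 - p|]ger0_norm ?subr_ge0// [`|0 - p|]ler0_norm ?subr_le0//.
rewrite /bitvar; ring.
Qed.

Lemma noise_kernel1_ge0 x z : 0 <= noise_kernel p 1 x z.
Proof.
case/andP: p01' => p0 p1.
apply: prodr_ge0 => i _; rewrite mul1r /cbit.
by case: (x i) (z i) => [] [] /=; nra.
Qed.

(** [noise 1] is an average against a probability kernel. *)
Lemma expect_norm_noise g :
  E (fun x => `|noise 1 g x|) <= E (fun x => `|g x|).
Proof.
apply: (@le_trans _ _ (E (fun x => E (fun z => noise_kernel p 1 x z * `|g z|)))).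
  apply: le_expect => // x; apply: le_trans (ler_norm_sum _ _ _) _.
  apply: ler_sum => z _.
  by rewrite !normrM ger0_norm ?cube_pmf_ge0// ger0_norm ?noise_kernel1_ge0.
rewrite /cube_expect; under eq_bigr do rewrite mulr_sumr.
rewrite exchange_big/=; apply: ler_sum => z _.
have k1 : E (fun x => noise_kernel p 1 x z) = 1.
  rewrite (expect_prod p (fun i b => 1 + 1 * (psi b * psi (z i)))).
  rewrite big1// => i _; rewrite sum_bit /cbit/=; ring.
have -> : cube_pmf p z * `|g z| = E (noise_kernel p 1 ^~ z) * (cube_pmf p z * `|g z|).
  by rewrite k1 mul1r.
rewrite mulr_suml; apply: ler_sum => x _.
by rewrite le_eqVlt; apply/orP; left; apply/eqP => /=; ring.
Qed.

(** Dual form of hypercontractivity, interpolated: with [G = noise 1 (noise 1 g)],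
[N] the second moment of [noise 1 g] equals the pairing of [g] with [G]; two
uses of Cauchy-Schwarz bound it by the first moment of [|g|], the second
moment of [g] and the fourth moment of [G], and the latter is at most [N ^+ 2]. *)
Lemma noise_L1_L2 g :
  E (fun x => noise 1 g x ^+ 2) ^+ 2 <=
  E (fun x => `|g x|) ^+ 2 * E (fun x => g x ^+ 2).
Proof.
set N := E _; set a := E _; set b := E _.
have N0 : 0 <= N by apply: expect_ge0 => // x; exact: sqr_ge0.
have a0 : 0 <= a by apply: expect_ge0.
have b0 : 0 <= b by apply: expect_ge0 => // x; exact: sqr_ge0.
pose G := noise 1 (noise 1 g).
have w0 x : 0 <= cube_pmf p x by exact: cube_pmf_ge0.
have NE : N = E (fun x => g x * G x).
  rewrite /N; under eq_expect do rewrite expr2.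
  rewrite !(parseval p01); apply: eq_bigr => S _.
  by rewrite /G !fhat_noise; congr (_ / _); ring.
pose c := E (fun x => `|g x| * G x ^+ 2).
have c0 : 0 <= c by apply: expect_ge0 => // x; rewrite mulr_ge0 ?sqr_ge0.
have H1 : N ^+ 2 <= a * c.
  have := @cauchy_schwarz_sum R _ (fun x => cube_pmf p x * `|g x|)
    (fun=> 1) (fun x => `|G x|).
  have -> : \sum_x cube_pmf p x * `|g x| * 1 ^+ 2 = a.
    by apply: eq_bigr => x _; rewrite expr1n mulr1.
  have -> : \sum_x cube_pmf p x * `|g x| * `|G x| ^+ 2 = c.
    by apply: eq_bigr => x _; rewrite real_normK ?num_real ?mulrA.
  move=> /(_ (fun x => mulr_ge0 (w0 x) (normr_ge0 (g x)))); apply: le_trans.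
  rewrite ler_pXn2r ?nnegrE//; last first.
    by apply: sumr_ge0 => x _; rewrite !mulr_ge0.
  rewrite NE; apply: ler_sum => x _.
  by rewrite mul1r -mulrA ler_wpM2l// -normrM ler_norm.
have H2 : c ^+ 2 <= b * N ^+ 2.
  apply: le_trans (@cauchy_schwarz_sum R _ (cube_pmf p)
    (fun x => `|g x|) (fun x => G x ^+ 2) w0) _.
  have -> : \sum_x cube_pmf p x * `|g x| ^+ 2 = b.
    by apply: eq_bigr => x _; rewrite real_normK ?num_real.
  rewrite ler_wpM2l//; apply: le_trans (noise_hyper p01 (noise 1 g)).
  rewrite le_eqVlt; apply/orP; left; apply/eqP.
  by apply: eq_bigr => x _; rewrite -exprM.
have [->|N_neq0] := eqVneq N 0; first by rewrite expr0n mulr_ge0 ?sqr_ge0.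
have N_gt0 : 0 < N ^+ 2 by rewrite exprn_gt0// lt0r N_neq0.
rewrite -(ler_pM2r N_gt0).
apply: (@le_trans _ _ (a ^+ 2 * c ^+ 2)); last first.
  by rewrite -[leRHS]mulrA ler_wpM2l// sqr_ge0.
by rewrite -[leRHS]exprMn -expr2 lerXn2r ?nnegrE ?sqr_ge0 ?mulr_ge0.
Qed.

(** The part of the pairing of [f] with its noisy version at noise [d] that is
carried by nonempty sets of coordinates. *)
Definition energy d f : R :=
  \sum_(S | level S != 0%N) d ^+ level S * (fhat f S ^+ 2 / v ^+ level S).

Lemma level_eq0 S : (level S == 0)%N = (S == [ffun=> false]).
Proof.
rewrite sum_nat_eq0; apply/forallP/eqP => [H|-> i]; last by rewrite ffunE.
by apply/ffunP => i; rewrite ffunE; have := H i; case: (S i).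
Qed.

Lemma VAR_energy (A : {set cube n}) (eta : R) :
  VAR p A eta = energy (1 - eta) (fun x => (x \in A)%:R).
Proof.
set f := fun x => _.
have fhat0 : fhat f [ffun=> false] = nu_prod p A.
  rewrite /nu_prod [RHS]big_mkcond; apply: eq_bigr => x _.
  rewrite /chi big1 ?mulr1; last by move=> i _; rewrite ffunE.
  by rewrite /f; case: ifP; rewrite ?mulr1 ?mulr0.
transitivity (E (fun x => f x * noise ((1 - eta) / v) f x) - nu_prod p A ^+ 2).
  congr (_ - _); apply: eq_expect => x.
  rewrite -(expect_resample p01) subKr -expectZ; apply: eq_expect => x'.
  by rewrite -expectZ.
rewrite expect_noise (bigD1 [ffun=> false])//= fhat0.
have -> : @level n [ffun=> false] = 0%N.
  by apply/eqP; rewrite level_eq0.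
rewrite expr0 mul1r -expr2 addrAC subrr add0r; apply: eq_big => S.
  by rewrite level_eq0.
by move=> _; rewrite exprMn exprVn -expr2 mulrAC mulrA.
Qed.

Lemma energy_le d d' f : 0 <= d <= d' -> energy d f <= energy d' f.
Proof.
move=> /andP[d0 dd]; apply: ler_sum => S _.
rewrite ler_wpM2r ?divr_ge0 ?sqr_ge0// ?(ltW (ev_gt0 _))//.
by rewrite lerXn2r ?nnegrE// (le_trans d0).
Qed.

Lemma energy_ge0 d f : 0 <= d -> 0 <= energy d f.
Proof.
move=> d0; apply: sumr_ge0 => S _.
by rewrite mulr_ge0 ?exprn_ge0// divr_ge0 ?sqr_ge0// ltW.
Qed.

(** Concavity of the power replaces log-convexity of the correlation in the
time of the noise semigroup; it spares any loss when the noise is small. *)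
Lemma energy_powR d l f : E (fun x => f x ^+ 2) <= 1 -> 0 <= d -> 0 < l <= 1 ->
  energy (d `^ l) f <= energy d f `^ l.
Proof.
move=> f1 d0 l01.
pose w S : R := if level S != 0%N then fhat f S ^+ 2 / v ^+ level S else 0.
have w0 S : 0 <= w S.
  by rewrite /w; case: ifP => // _; rewrite divr_ge0 ?sqr_ge0// ltW.
have t0 S : 0 <= d ^+ level S by rewrite exprn_ge0.
have w1 : \sum_S w S <= 1.
  apply: le_trans f1; under [leRHS]eq_expect do rewrite expr2.
  rewrite (parseval p01); apply: ler_sum => S _; rewrite /w -expr2.
  by case: ifP => // _; rewrite divr_ge0 ?sqr_ge0// ltW.
have := sum_powR_concave w0 t0 w1 l01.
have -> : \sum_S w S * d ^+ level S = energy d f.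
  rewrite /energy [RHS]big_mkcond; apply: eq_bigr => S _ /=; rewrite /w.
  by case: ifP; rewrite ?mul0r// mulrC.
apply: le_trans; rewrite /energy big_mkcond le_eqVlt; apply/orP; left.
apply/eqP; apply: eq_bigr => S _ /=; rewrite /w.
case: ifP; rewrite ?mul0r// mulrC => _; congr (_ * _).
by rewrite -!powR_mulrn ?powR_ge0// -!powRrM mulrC.
Qed.

Lemma level_decay S : (level S)%:R * v ^+ level S * v ^+ level S <= 1.
Proof.
have v4 := bitvar_le4 p; move: (level S) => k.
have vk1 j : v ^+ j <= 1 by rewrite exprn_ile1 ?ltW//; lra.
elim: k => [|k IH]; first by rewrite !mul0r.
have : 0 <= k%:R * v ^+ k * v ^+ k by rewrite !mulr_ge0 ?exprn_ge0// ltW.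
have -> : k.+1%:R * v ^+ k.+1 * v ^+ k.+1 =
    v ^+ 2 * (k%:R * v ^+ k * v ^+ k) + v ^+ 2 * (v ^+ k * v ^+ k).
  rewrite -natr1 exprS; ring.
have v2 : v ^+ 2 <= 1 / 16 by rewrite expr2; have := v_gt0; nra.
have kk : v ^+ k * v ^+ k <= 1 by rewrite mulr_ile1 ?exprn_ge0// ltW.
have kk0 : 0 <= v ^+ k * v ^+ k by rewrite mulr_ge0// ltW.
have := sqr_ge0 v.
move: (k%:R * v ^+ k * v ^+ k) IH => t; nra.
Qed.

(** Every nonempty [S] lies above some coordinate, so the energy is at most the
sum of the energies of the fluctuations.  Half of the noise is spent on
[noise_L1_L2], and the other half keeps the sum of the second moments bounded
(through [level_decay]), so that Cauchy-Schwarz over the coordinates applies. *)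
Lemma energy_fluct f : E (fun x => f x ^+ 2) <= 1 ->
  energy (v ^+ 4) f ^+ 2 <= \sum_i E (fun x => `|fluct i f x|) ^+ 2.
Proof.
move=> f1.
pose g i := noise 1 (fluct i f).
have ghat i S : fhat (g i) S = (S i)%:R * (v ^+ level S * fhat f S).
  rewrite /g fhat_noise mul1r fhat_fluct.
  by case: (S i); rewrite ?mul1r// mul0r mulr0.
pose N i := E (fun x => noise 1 (g i) x ^+ 2).
pose b i := E (fun x => g i x ^+ 2).
pose a i := E (fun x => `|fluct i f x|).
have b0 i : 0 <= b i by apply: expect_ge0 => // x; exact: sqr_ge0.
have a0 i : 0 <= a i by apply: expect_ge0.
have N0 i : 0 <= N i by apply: expect_ge0 => // x; exact: sqr_ge0.
have bE i : b i = \sum_(S : cube n) (S i)%:R * (v ^+ level S * fhat f S ^+ 2).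
  rewrite /b; under eq_expect do rewrite expr2.
  rewrite (parseval p01); apply: eq_bigr => S _; rewrite ghat.
  case: (S i); rewrite ?mul0r// !mul1r.
  by field; rewrite gt_eqF.
have NE i : N i = \sum_(S : cube n)
    (S i)%:R * (v ^+ level S * v ^+ level S * v ^+ level S * fhat f S ^+ 2).
  rewrite /N; under eq_expect do rewrite expr2.
  rewrite (parseval p01); apply: eq_bigr => S _; rewrite fhat_noise mul1r ghat.
  case: (S i); rewrite ?mul0r ?mulr0 ?mul0r// !mul1r.
  by field; rewrite gt_eqF.
have levelE S : \sum_i (S i)%:R = (level S)%:R :> R by rewrite -natr_sum.
have sumb : \sum_i b i <= 1.
  apply: le_trans f1; under [leRHS]eq_expect do rewrite expr2.
  rewrite (parseval p01); under eq_bigr do rewrite bE.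
  rewrite exchange_big/=; apply: ler_sum => S _.
  rewrite -mulr_suml levelE ler_pdivlMr// mulrA -expr2 -[leRHS]mul1r mulrAC.
  by rewrite ler_wpM2r ?sqr_ge0// level_decay.
have sumN : energy (v ^+ 4) f <= \sum_i N i.
  under eq_bigr do rewrite NE.
  rewrite exchange_big/= /energy big_mkcond; apply: ler_sum => S _ /=.
  rewrite -mulr_suml levelE.
  have t0 : 0 <= v ^+ level S * v ^+ level S * v ^+ level S * fhat f S ^+ 2.
    by rewrite mulr_ge0 ?sqr_ge0// ?mulr_ge0// ltW.
  case: ifPn => [l0|_]; last by rewrite mulr_ge0.
  have -> : (v ^+ 4) ^+ level S * (fhat f S ^+ 2 / v ^+ level S) =
      v ^+ level S * v ^+ level S * v ^+ level S * fhat f S ^+ 2.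
    rewrite exprAC; field; by rewrite gt_eqF.
  by rewrite ler_peMl// ler1n lt0n.
have NaB i : N i <= a i * Num.sqrt (b i).
  rewrite -(@ler_pXn2r _ 2%N)// ?nnegrE ?mulr_ge0 ?sqrtr_ge0//.
  rewrite exprMn sqr_sqrtr//; apply: le_trans (noise_L1_L2 (g i)) _.
  apply: ler_wpM2r; first exact: b0.
  by apply: lerXn2r; rewrite ?nnegrE ?expect_norm_noise ?expect_ge0.
apply: (@le_trans _ _ ((\sum_i a i * Num.sqrt (b i)) ^+ 2)).
  rewrite lerXn2r ?nnegrE ?energy_ge0 ?(ltW (ev_gt0 _))//.
    by apply: sumr_ge0 => i _; rewrite mulr_ge0 ?sqrtr_ge0.
  by apply: (le_trans sumN); exact: ler_sum.
have := @cauchy_schwarz_sum R 'I_n (fun=> 1) a (fun i => Num.sqrt (b i)).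
under eq_bigr do rewrite mul1r.
under [X in _ -> _ <= X * _]eq_bigr do rewrite mul1r.
under [X in _ -> _ <= _ * X]eq_bigr do rewrite mul1r sqr_sqrtr//.
move=> /(_ (fun=> ler01)) /le_trans; apply.
by rewrite ler_piMr// sumr_ge0// => i _; exact: sqr_ge0.
Qed.

(** The fluctuation vanishes unless the fiber is a single point; then the fiber
has measure [p] or [1 - p], and [h] is at least [v] there. *)
Lemma le_h_influence (h : R -> R) (A : {set cube n}) i :
  (forall t, 0 <= h t) -> v <= h p -> v <= h (1 - p) ->
  E (fun x => `|fluct i (fun x => (x \in A)%:R) x|) <=
  2 * h_influence h p A i.
Proof.
move=> h0 hp hq; rewrite expect_norm_fluct -mulrA ler_wpM2l// /h_influence.
rewrite -expectZ; apply: le_expect => // x.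
have inB b : (b \in fiber A i x) = (set_bit x i b \in A) by rewrite inE.
have nuE : nu p (fiber A i x) = (set_bit x i true \in A)%:R * p +
    (set_bit x i false \in A)%:R * (1 - p).
  rewrite /nu big_mkcond big_bool/= !inB.
  by case: ifP; case: ifP; rewrite ?mul1r ?mul0r.
rewrite nuE; case: (set_bit x i true \in A); case: (set_bit x i false \in A);
  rewrite /= ?mul1r ?mul0r ?subrr ?normr0 ?mulr0 ?subr0 ?sub0r ?normrN
  ?normr1 ?mulr1 ?addr0 ?add0r //.
Qed.

(** All noise levels reduce to the level [v ^+ 4] through [energy_powR]; the
exponent [l] records how far the given noise is from that level. *)
Lemma VAR_le (h : R -> R) (A : {set cube n}) (eta l : R) :
  (forall t, 0 <= h t) -> v <= h p -> v <= h (1 - p) ->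
  eta <= 1 -> 0 < l <= 1 -> 1 - eta <= (v ^+ 4) `^ l ->
  VAR p A eta <= 2 * (\sum_i h_influence h p A i ^+ 2) `^ (l / 2).
Proof.
move=> h0 hp hq eta1 /andP[l0 l1] etal; rewrite VAR_energy.
set f := fun x => _; set Y := \sum_i _.
have Y0 : 0 <= Y by apply: sumr_ge0 => i _; exact: sqr_ge0.
have f1 : E (fun x => f x ^+ 2) <= 1.
  rewrite -[leRHS](@expect_cst R n p 1); apply: le_expect => // x.
  by rewrite /f; case: (_ \in _); rewrite ?expr1n ?expr0n.
have en0 : 0 <= energy (v ^+ 4) f by apply: energy_ge0; rewrite ltW.
apply: (le_trans (energy_le (d' := (v ^+ 4) `^ l) _ _)).
  by rewrite subr_ge0 eta1.
apply: (le_trans (energy_powR f1 _ _)); rewrite ?l0 ?(ltW (ev_gt0 _))//.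
have {}en : energy (v ^+ 4) f <= 2 * Y `^ (2^-1).
  rewrite -(@ler_pXn2r _ 2%N)// ?nnegrE ?mulr_ge0 ?powR_ge0//.
  apply: (le_trans (energy_fluct f1)).
  rewrite exprMn -[(Y `^ _) ^+ 2]powR_mulrn ?powR_ge0// -powRrM mulVf ?pnatr_eq0//.
  rewrite powRr1// mulr_sumr; apply: ler_sum => i _; rewrite -exprMn.
  have hi0 : 0 <= h_influence h p A i by apply: expect_ge0.
  rewrite lerXn2r ?nnegrE ?mulr_ge0// ?le_h_influence//.
  exact: expect_ge0.
have := ge0_ler_powR (ltW l0) _ _ en.
rewrite !nnegrE => /(_ en0); rewrite mulr_ge0 ?powR_ge0// => /(_ isT).
move=> /le_trans; apply.
rewrite powRM ?powR_ge0// -powRrM [_^-1 * l]mulrC ler_wpM2r ?powR_ge0//.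
by rewrite -[leRHS]powRr1 ?ler_powR// ler1n.
Qed.

End influences.

(** * The Gaussian density *)

Section density.
Local Open Scope classical_set_scope.
Local Open Scope ring_scope.
Context {R : realType}.
Implicit Types (x y w a c : R).
Local Notation mu := (@lebesgue_measure R).
Local Notation phi := (@gauss_pdf R).

Definition peak : R := normal_peak 1.

Lemma peak_gt0 : 0 < peak.
Proof. exact: normal_peak_gt0. Qed.

Lemma peak2 : peak ^+ 2 = (2 * pi)^-1.
Proof.
rewrite /peak /normal_peak expr1n mul1r exprVn sqr_sqrtr ?mulr_natl//.
by rewrite mulrn_wge0// pi_ge0.
Qed.

Lemma phiE x : phi x = peak * expR (- x ^+ 2 / 2).
Proof. by rewrite /gauss_pdf normal_pdfE ?oner_eq0// /normal_fun subr0 expr1n. Qed.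

Lemma phi_gt0 x : 0 < phi x.
Proof. by rewrite phiE mulr_gt0 ?expR_gt0// peak_gt0. Qed.

Lemma phi_ge0 x : 0 <= phi x.
Proof. exact/ltW/phi_gt0. Qed.

Lemma phiN x : phi (- x) = phi x.
Proof. by rewrite !phiE sqrrN. Qed.

Lemma continuous_phi : continuous phi.
Proof. by apply: continuous_normal_pdf; exact: oner_neq0. Qed.

Lemma is_derive_phi x : is_derive x 1 phi (- x * phi x).
Proof.
have -> : phi = (fun x => peak * expR (- x ^+ 2 / 2)).
  by apply/funext => y; exact: phiE.
by apply: is_derive_eq; rewrite /GRing.scale/=; field.
Qed.

(** Rotation invariance of the planar Gaussian density. *)
Lemma phiM_eq x y x' y' : x ^+ 2 + y ^+ 2 = x' ^+ 2 + y' ^+ 2 ->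
  phi x * phi y = phi x' * phi y'.
Proof.
move=> e; rewrite !phiE mulrACA -expRD [RHS]mulrACA -expRD; congr (_ * expR _).
by rewrite -!mulrDl -!opprD e.
Qed.

Lemma cvg_phiy : phi x @[x --> +oo%R] --> (0 : R).
Proof.
have -> : (0 : R) = peak * 0 by rewrite mulr0.
have -> : phi = (fun x => peak * expR (- (x ^+ 2 / 2))).
  by apply/funext => y; rewrite phiE mulNr.
apply: cvgMr; apply: (cvg_comp (fun x => x ^+ 2 / 2) (fun x => expR (- x))).
  by apply: gt0_cvgMly => //; exact: cvgr_expr2.
exact: cvgr_expR.
Qed.

Definition gauss_tail c : \bar R := (\int[mu]_(t in `[c, +oo[) (phi t)%:E)%E.

Lemma cvg_affiney (c d : R) : 0 < c -> (c * x + d) @[x --> +oo%R] --> +oo%R.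
Proof.
move=> c0; apply: (@cvg_comp _ _ _ (fun x => c * x) (fun x => x + d)).
  by apply: gt0_cvgMry => //; exact: cvg_id.
exact: cvg_addrr.
Qed.

Lemma derive1_fun (f df : R -> R) :
  (forall x, is_derive x 1 f (df x)) -> derive1 f = df.
Proof. by move=> H; apply/funext => x; rewrite derive1E; have [] := H x. Qed.

Lemma tail_affine (a c d : R) : 0 < c ->
  (\int[mu]_(x in `[a, +oo[) (c * phi (c * x + d))%:E)%E = gauss_tail (c * a + d).
Proof.
move=> c0; pose F x := c * x + d.
have dF x : is_derive x 1 F c.
  by apply: is_derive_eq; rewrite /GRing.scale/=; ring.
have F'E : derive1 F = cst c by exact: derive1_fun.
rewrite /gauss_tail -/(F a) increasing_ge0_integration_by_substitutiony//=.
- apply: eq_integral => x _; rewrite F'E mulrC //.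
- by move=> x y _ _ xy; rewrite /F ltrD2r ltr_pM2l.
- by rewrite F'E => x _; exact: cst_continuous.
- by rewrite F'E; exact: is_cvg_cst.
- by rewrite F'E; exact: is_cvg_cst.
- split; first by move=> x _; exact: ex_derive.
  apply: cvg_at_right_filter; apply: differentiable_continuous.
  by apply/derivable1_diffP; exact: ex_derive.
- exact: cvg_affiney.
- by apply: continuous_subspaceT; exact: continuous_phi.
- by move=> x _; exact: phi_ge0.
Qed.

End density.

(** * The moving threshold *)

Section plackett.
Local Open Scope classical_set_scope.
Local Open Scope ring_scope.
Context {R : realType}.
Implicit Types (x y w a c s : R).
Local Notation mu := (@lebesgue_measure R).
Local Notation phi := (@gauss_pdf R).

(** Let [w = 1 / x].  Given [W = y], the event [W' > a] is that an independent
standard Gaussian exceeds [threshold (a - y) (a + y) w]; using [w] puts the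
limit of perfect correlation at infinity. *)
Definition threshold c s w : R := (c * w + s / w) / 2.
Definition threshold_rate c s w : R := (c - s / w ^+ 2) / 2.

Lemma is_derive_threshold c s w : w != 0 ->
  is_derive w 1 (threshold c s) (threshold_rate c s w).
Proof.
move=> w0; apply: is_derive_eq.
  apply: is_deriveM; apply: is_deriveD; apply: is_deriveM.
  exact: is_deriveV.
rewrite /GRing.scale/= /threshold_rate; by field.
Qed.

Lemma cvg_invy : w^-1 @[w --> +oo%R] --> (0 : R).
Proof.
apply/gtr0_cvgV0; first by near=> w.
exact: cvg_id.
Unshelve. all: by end_near. Qed.

(** For [c > 0 > s] the threshold increases to infinity with [w], so this is the
change of variables from the threshold to [w]. *)
Lemma tail_threshold c s w0 : 0 < c -> s < 0 -> 0 < w0 ->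
  (\int[mu]_(w in `[w0, +oo[) (phi (threshold c s w) * threshold_rate c s w)%:E)%E =
  gauss_tail (threshold c s w0).
Proof.
move=> c0 s0 w00; pose F := threshold c s.
have dF w : 0 < w -> is_derive w 1 F (threshold_rate c s w).
  by move=> w_gt0; apply: is_derive_threshold; rewrite gt_eqF.
have F'E w : 0 < w -> derive1 F w = threshold_rate c s w.
  by move=> /dF[_]; rewrite derive1E.
have cdu w : 0 < w -> threshold_rate c s z @[z --> w] --> threshold_rate c s w.
  move=> w_gt0; apply: cvgMl; apply: cvgB; first exact: cvg_cst.
  apply: cvgMr; apply: cvgV; first by rewrite expf_neq0// gt_eqF.
  exact: exprn_continuous.
have cF' w : 0 < w -> derive1 F z @[z --> w] --> threshold_rate c s w.
  move=> w_gt0; apply: cvg_trans (cdu _ w_gt0); apply: near_eq_cvg.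
  near=> z; rewrite F'E//.
  by near: z; exact: lt_nbhsr.
have incr w w' : 0 < w -> w < w' -> F w < F w'.
  move=> w_gt0 ww'; rewrite /F /threshold ltr_pM2r//.
  apply: ltrD; first by rewrite ltr_pM2l.
  by rewrite ltr_nM2l// ltf_pV2 ?posrE// (lt_trans w_gt0).
rewrite /gauss_tail -/(F w0) increasing_ge0_integration_by_substitutiony//=.
- apply: eq_integral => x; rewrite inE/= in_itv/= andbT => w0x.
  rewrite [RHS](_ : _ = (phi (F x) * derive1 F x)%:E)//.
  by rewrite F'E// (lt_le_trans w00).
- move=> x y; rewrite !in_itv/= !andbT => w0x _ xy.
  by apply: incr => //; exact: lt_le_trans w0x.
- move=> x; rewrite in_itv/= andbT => w0x.
  rewrite /continuous_at F'E ?(lt_trans w00)//.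
  by apply: cF'; exact: lt_trans w0x.
- apply/cvg_ex; exists (threshold_rate c s w0); apply: cvg_at_right_filter.
  exact: cF'.
- apply/cvg_ex; exists ((c - s * (0 * 0)) / 2).
  apply: cvg_trans (_ : (c - s * (z^-1 * z^-1)) / 2 @[z --> +oo%R] --> _).
    apply: near_eq_cvg; near=> z; rewrite F'E// /threshold_rate expr2 invfM//.
  apply: cvgMl; apply: cvgB; first exact: cvg_cst.
  by apply: cvgMr; apply: cvgM; exact: cvg_invy.
- split.
    move=> x; rewrite in_itv/= andbT => w0x.
    by have [] := dF _ (lt_trans w00 w0x).
  apply: cvg_at_right_filter; apply: differentiable_continuous.
  by apply/derivable1_diffP; have [] := dF _ w00.
- apply: (@ger_cvgy _ _ _ _ (fun z => c / 2 * z + s / w0 / 2)); last first.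
    by apply: cvg_affiney; rewrite divr_gt0.
  near=> z; rewrite /F /threshold mulrDl mulrAC lerD2l ler_pM2r// ler_nM2l//.
  by rewrite lef_pV2 ?posrE.
- by apply: continuous_subspaceT; exact: continuous_phi.
- by move=> x _; exact: phi_ge0.
Unshelve. all: by end_near. Qed.

Lemma threshold_integrand_ge0 a y w : a < 0 -> 0 < w -> y < a ->
  0 <= phi y * (phi (threshold (a - y) (a + y) w) * threshold_rate (a - y) (a + y) w).
Proof.
move=> a0 w0 ya; apply: mulr_ge0; first exact: phi_ge0.
apply: mulr_ge0; first exact: phi_ge0.
rewrite /threshold_rate divr_ge0// subr_ge0.
apply: (@le_trans _ _ 0); last by rewrite subr_ge0 ltW.
by rewrite pmulr_lle0 ?invr_gt0 ?exprn_gt0//; lra.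
Qed.

(** The rate at which the quadrant probability decreases in [w]; compare
[quadrant_rate], its rate of increase in [x = 1 / w]. *)
Definition quadrant_rate_inv a w : R := 2 * phi a * phi (a / w) / (1 + w ^+ 2).

(** By rotation invariance, the product of the two densities is
[phi a * phi (c * t + d)] and [threshold_rate] is proportional to [c * t + d],
so the integrand is an exact derivative.  The half-line is reflected first, and
[t] stands for [- y]. *)
Lemma integral_quadrant_rate_inv a w : a < 0 -> 0 < w ->
  (\int[mu]_(y in `]-oo, a])
    (phi y * (phi (threshold (a - y) (a + y) w) *
              threshold_rate (a - y) (a + y) w))%:E)%E =
  (quadrant_rate_inv a w)%:E.
Proof.
move=> a0 w0.
have wN0 : w != 0 by rewrite gt_eqF.
have w2N0 : 1 + w ^+ 2 != 0 by rewrite gt_eqF// ltr_pwDl// sqr_ge0.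
pose c := (w ^+ 2 + 1) / (2 * w).
have c0 : 0 < c by rewrite divr_gt0 ?mulr_gt0// ltr_wpDl ?sqr_ge0.
pose d := a * (w ^+ 2 - 1) / (2 * w).
pose f t := phi a * phi (c * t + d) * (c * t + d) / w.
pose F t := - (2 * phi a * phi (c * t + d) / (1 + w ^+ 2)).
(* with [y = - t], the points [(y, threshold)] and [(a, c * t + d)] have the
   same distance to the origin *)
have fE t : phi (- t) * (phi (threshold (a + t) (a - t) w) *
    threshold_rate (a + t) (a - t) w) = f t.
  rewrite mulrA (@phiM_eq _ _ _ a (c * t + d)).
    by rewrite /f -!mulrA; congr (_ * (_ * _)); rewrite /threshold_rate /c /d; field.
  by rewrite /threshold /c /d; field.
have dF (t : R) : is_derive t 1 F (f t).
  have H : is_derive t 1 (fun s : R => phi (c * s + d))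
      (c * (- (c * t + d) * phi (c * t + d))).
    apply: is_derive_eq.
      apply: is_derive1_comp; exact: is_derive_phi.
    by rewrite /GRing.scale/=; ring.
  apply: is_derive_eq; rewrite /GRing.scale/= /f /c.
  by field; rewrite wN0.
have cont_f : continuous f.
  move=> t; apply: cvgMl; apply: cvgM.
    apply: cvgMr; apply: (cvg_comp _ phi); last exact: continuous_phi.
    by apply: cvgD; [apply: cvgMr; exact: cvg_id|exact: cvg_cst].
  by apply: cvgD; [apply: cvgMr; exact: cvg_id|exact: cvg_cst].
rewrite -[a in `]-oo, a]]opprK ge0_integration_by_substitutionNy//.
- transitivity (\int[mu]_(t in `[(- a)%R, +oo[) (f t)%:E)%E.
    by apply: eq_integral => t _ /=; rewrite -fE opprK.
  rewrite (@ge0_continuous_FTC2y _ f F (- a) 0).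
  + congr (_%:E); rewrite /F sub0r opprK /quadrant_rate_inv -(phiN (a / w)).
    congr (_ * phi _ / _).
    by rewrite /c /d; field.
  + move=> t at0; rewrite /f divr_ge0 ?(ltW w0)// mulr_ge0 ?mulr_ge0 ?phi_ge0//.
    apply: (@le_trans _ _ (c * - a + d)); last by rewrite lerD2r ler_pM2l.
    rewrite (_ : _ + _ = - a / w); last by rewrite /c /d; field.
    by rewrite divr_ge0 ?(ltW w0)// oppr_ge0 ltW.
  + exact: continuous_subspaceT.
  + rewrite -[X in _ --> X]oppr0 -[X in _ --> - X](mul0r (1 + w ^+ 2)^-1).
    apply: cvgN; apply: cvgMl; rewrite -[X in _ --> X](mulr0 (2 * phi a)).
    apply: cvgMr; apply: (cvg_comp _ phi); last exact: cvg_phiy.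
    exact: cvg_affiney.
  + by move=> x _; have [] := dF x.
  + apply: cvg_at_right_filter; apply: differentiable_continuous.
    by apply/derivable1_diffP; have [] := dF (- a).
  + by move=> x _; rewrite (derive1_fun dF).
- apply: continuous_subspaceT => y.
  have -> : (fun y => phi y * (phi (threshold (a - y) (a + y) w) *
      threshold_rate (a - y) (a + y) w)) = f \o -%R.
    by apply/funext => z /=; rewrite -fE !opprK.
  by apply: continuous_comp; [exact: opp_continuous|exact: cont_f].
- by move=> y; rewrite opprK in_itv/= => ya; exact: threshold_integrand_ge0.
Qed.

End plackett.

(** * Integrals over rectangles *)

Section rectangles.
Local Open Scope classical_set_scope.
Local Open Scope ring_scope.
Context {R : realType}.
Local Notation mu := (@lebesgue_measure R).

(** Away from 0 this is continuity; multiplying by [w] the real power of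
[w ^+ 2] takes care of 0, whose inverse is 0 by convention. *)
Lemma measurable_inv : measurable_fun setT (@GRing.inv R).
Proof.
have -> : @GRing.inv R = (fun w => w * (w ^+ 2) `^ (-1)).
  apply/funext => w; rewrite powR_inv1 ?sqr_ge0//.
  have [->|w0] := eqVneq w 0; first by rewrite invr0 mul0r.
  by field.
apply: measurable_funM; first exact: measurable_id.
apply: (measurableT_comp (measurable_powR _)).
exact: measurable_funX.
Qed.

Variables (D1 D2 : set R) (f : R * R -> R).
Hypotheses (mD1 : measurable D1) (mD2 : measurable D2).
Hypothesis mf : measurable_fun setT f.
Hypothesis f0 : forall x y, D1 x -> D2 y -> 0 <= f (x, y).

Let g (z : R * R) : \bar R := (f z * (\1_D1 z.1 * \1_D2 z.2))%:E.

Let mg : measurable_fun setT g.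
Proof.
apply/measurable_EFinP; apply: measurable_funM => //.
by apply: measurable_funM; apply: measurableT_comp => //; exact: measurable_indic.
Qed.

Let g0 z : (0 <= g z)%E.
Proof.
case: z => x y; rewrite /g lee_fin !indicE/=.
have [/set_mem xD1|_] := boolP (x \in D1); last by rewrite mul0r mulr0.
have [/set_mem yD2|_] := boolP (y \in D2); last by rewrite !mulr0.
by rewrite !mulr1; exact: f0.
Qed.

Let gF x : fubini_F mu g x = ((fun x => \int[mu]_(y in D2) (f (x, y))%:E)%E \_ D1) x.
Proof.
rewrite /fubini_F patchE /g/= indicE; case: ifPn => xD1.
  rewrite [RHS]integral_mkcond; apply: eq_integral => y _.
  by rewrite patchE indicE mul1r; case: ifPn => yD2; rewrite ?mulr1 ?mulr0.
by apply: integral0_eq => y _; rewrite mul0r mulr0.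
Qed.

Let gG y : fubini_G mu g y = ((fun y => \int[mu]_(x in D1) (f (x, y))%:E)%E \_ D2) y.
Proof.
rewrite /fubini_G patchE /g/= [\1_D2 _]indicE; case: ifPn => yD2.
  rewrite [RHS]integral_mkcond; apply: eq_integral => x _.
  by rewrite patchE indicE mulr1; case: ifPn => xD1; rewrite ?mulr1 ?mulr0.
by apply: integral0_eq => x _; rewrite mulr0 mulr0.
Qed.

Lemma integral_rect :
  (\int[mu \x mu]_(z in D1 `*` D2) (f z)%:E =
   \int[mu]_(x in D1) \int[mu]_(y in D2) (f (x, y))%:E)%E.
Proof.
rewrite [RHS]integral_mkcond.
transitivity (\int[mu]_x fubini_F mu g x)%E; last first.
  by apply: eq_integral => x _; exact: gF.
rewrite -fubini_tonelli1// [LHS]integral_mkcond; apply: eq_integral => -[x y] _.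
rewrite patchE /g !indicE/=.
have -> : ((x, y) \in D1 `*` D2) = (x \in D1) && (y \in D2).
  by apply/idP/andP; rewrite !inE.
by case: (x \in D1) (y \in D2) => [] []; rewrite /= ?mulr1 ?mulr0 ?mul0r ?mulr0.
Qed.

Lemma tonelli_rect :
  (\int[mu]_(x in D1) \int[mu]_(y in D2) (f (x, y))%:E =
   \int[mu]_(y in D2) \int[mu]_(x in D1) (f (x, y))%:E)%E.
Proof.
rewrite [LHS]integral_mkcond [RHS]integral_mkcond.
transitivity (\int[mu]_x fubini_F mu g x)%E.
  by apply: eq_integral => x _; rewrite gF.
transitivity (\int[mu]_y fubini_G mu g y)%E; first exact: fubini_tonelli.
by apply: eq_integral => y _; exact: gG.
Qed.

End rectangles.

(** * Probability of a quadrant *)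

Section orthant.
Local Open Scope classical_set_scope.
Local Open Scope ring_scope.
Context {R : realType}.
Implicit Types (x y z w a c s : R).
Local Notation mu := (@lebesgue_measure R).
Local Notation phi := (@gauss_pdf R).

Lemma measurable_phi : measurable_fun setT phi.
Proof. exact: measurable_normal_pdf. Qed.

(** Both iterated integrals are those of one nonnegative function of [(y, w)]. *)
Lemma quadrant_rate_invE a w0 : a < 0 -> 0 < w0 ->
  (\int[mu]_(y in `]-oo, a[) ((phi y)%:E * gauss_tail (threshold (a - y) (a + y) w0)) =
   \int[mu]_(w in `[w0, +oo[) (quadrant_rate_inv a w)%:E)%E.
Proof.
move=> a0 w00.
pose h (z : R * R) :=
  phi (threshold (a - z.1) (a + z.1) z.2) * threshold_rate (a - z.1) (a + z.1) z.2.
pose f (z : R * R) := phi z.1 * h z.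
have mfst : measurable_fun setT (fst : R * R -> R) by exact: measurable_fst.
have msnd : measurable_fun setT (snd : R * R -> R) by exact: measurable_snd.
have minv : measurable_fun setT (fun z : R * R => z.2^-1).
  exact: (measurableT_comp measurable_inv).
have mh : measurable_fun setT h.
  have mp : measurable_fun setT (fun z : R * R => a - z.1).
    exact: measurable_funB.
  have ms : measurable_fun setT (fun z : R * R => a + z.1).
    exact: measurable_funD.
  apply: measurable_funM.
    apply: (measurableT_comp measurable_phi).
    apply: measurable_funM => //; apply: measurable_funD.
      exact: measurable_funM.
    exact: measurable_funM.
  apply: measurable_funM => //; apply: measurable_funB => //.
  apply: measurable_funM => //.
  under eq_fun do rewrite -exprVn.
  exact: measurable_funX.
have mf : measurable_fun setT f.
  by apply: measurable_funM => //; exact: (measurableT_comp measurable_phi).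
transitivity (\int[mu]_(y in `]-oo, a[)
    \int[mu]_(w in `[w0, +oo[) (f (y, w))%:E)%E.
  apply: eq_integral => y; rewrite inE/= in_itv/= => ya.
  rewrite -tail_threshold ?subr_gt0//; last lra.
  rewrite -ge0_integralZl_EFin ?phi_ge0//.
  - move=> w; rewrite /= in_itv/= andbT => w0w; rewrite lee_fin.
    have := @threshold_integrand_ge0 R a y w a0 (lt_le_trans w00 w0w) ya.
    by rewrite pmulr_rge0 ?phi_gt0.
  - apply/measurable_EFinP.
    by apply: measurable_funTS; exact: (@measurable_fun_pair2 _ _ _ _ _ _ h y mh).
rewrite tonelli_rect//; last first.
  move=> y w; rewrite /= !in_itv/= andbT => ya w0w.
  exact: threshold_integrand_ge0 (lt_le_trans w00 w0w) ya.
apply: eq_integral => w; rewrite inE/= in_itv/= andbT => w0w.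
rewrite -(integral_quadrant_rate_inv a0 (lt_le_trans w00 w0w)).
apply: integral_itv_bndo_bndc.
apply/measurable_EFinP; apply: measurable_funTS.
exact: (@measurable_fun_pair1 _ _ _ _ _ _ f w mf).
Qed.

End orthant.

(** * Integration in the correlation, and the Gaussian distribution function *)

Section primitive.
Local Open Scope classical_set_scope.
Local Open Scope ring_scope.
Context {R : realType}.
Implicit Types (x y z w a c s : R).
Local Notation mu := (@lebesgue_measure R).
Local Notation phi := (@gauss_pdf R).

(** The primitive is differentiable on a neighbourhood of the half-line
[x >= 0], which dispenses with one-sided derivatives at 0. *)
Lemma primitive_exists (f : R -> R) : continuous f ->
  exists F : R -> R, F 0 = 0 /\ forall x, -1 < x -> is_derive x 1 F (f x).
Proof.
move=> cf; pose G x := \int[mu]_(t in `[-1, x]) f t.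
exists (fun x => G x - G 0); split; first by rewrite subrr.
move=> x x1.
have intf : mu.-integrable `[-1, x + 1] (EFin \o f).
  apply: continuous_compact_integrable; first exact: segment_compact.
  exact: continuous_subspaceT.
have xx : x < x + 1 by rewrite ltrDl.
have [dG G'] := continuous_FTC1_closed xx intf x1 (cf x).
have dG' : is_derive x 1 G (f x).
  by apply: DeriveDef => //; rewrite -G' derive1E.
by apply: is_derive_eq; rewrite subr0.
Qed.

Definition quadrant_rate a z : R := 2 * phi a * phi (a * z) / (1 + z ^+ 2).

Lemma sq1_gt0 z : 0 < 1 + z ^+ 2.
Proof. by rewrite ltr_pwDl// sqr_ge0. Qed.

Lemma sq1_neq0 z : 1 + z ^+ 2 != 0.
Proof. by rewrite gt_eqF// sq1_gt0. Qed.

Lemma continuous_quadrant_rate a : continuous (quadrant_rate a).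
Proof.
move=> z; apply: cvgM.
  apply: cvgMr; apply: (cvg_comp _ phi); last exact: continuous_phi.
  by apply: cvgMr; exact: cvg_id.
apply: cvgV; first exact: sq1_neq0.
by apply: cvgD; [exact: cvg_cst|exact: exprn_continuous].
Qed.

(** The function [- K (1 / w)] is a primitive of the rate in [w] and vanishes at
infinity. *)
Lemma integral_quadrant_rate_inv_primitive a w0 (K : R -> R) : 0 < w0 ->
  K 0 = 0 -> (forall x, -1 < x -> is_derive x 1 K (quadrant_rate a x)) ->
  (\int[mu]_(w in `[w0, +oo[) (quadrant_rate_inv a w)%:E = (K w0^-1)%:E)%E.
Proof.
move=> w00 K0 dK.
pose F w := - K w^-1.
have dF w : 0 < w -> is_derive w 1 F (quadrant_rate_inv a w).
  move=> w_gt0; have wN0 : w != 0 by rewrite gt_eqF.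
  have dw : is_derive w 1 (fun w : R => w^-1) (- w ^- 2).
    apply: is_derive_eq; first exact: is_deriveV.
    by rewrite /GRing.scale/= mulr1.
  have dKw : is_derive w^-1 1 K (quadrant_rate a w^-1).
    by apply: dK; rewrite (@lt_trans _ _ 0) ?invr_gt0// ltrN10.
  have H : is_derive w 1 (K \o (fun w : R => w^-1)) (- w ^- 2 * quadrant_rate a w^-1).
    by rewrite mulrC; exact: is_derive1_comp.
  have dN : is_derive w 1 F (- (- w ^- 2 * quadrant_rate a w^-1)) by exact: is_deriveN.
  apply: (is_derive_eq dN).
  rewrite mulNr opprK /quadrant_rate /quadrant_rate_inv.
  by field; rewrite sq1_neq0 wN0.
have ck (w : R) : 0 < w -> quadrant_rate_inv a z @[z --> w] --> quadrant_rate_inv a w.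
  move=> w_gt0; apply: cvgM.
    apply: cvgMr; apply: (cvg_comp _ phi); last exact: continuous_phi.
    by apply: cvgMr; apply: cvgV; [rewrite gt_eqF|exact: cvg_id].
  apply: cvgV; first exact: sq1_neq0.
  by apply: cvgD; [exact: cvg_cst|exact: exprn_continuous].
rewrite (@ge0_continuous_FTC2y _ (quadrant_rate_inv a) F w0 0).
- by rewrite /F sub0e EFinN oppeK.
- move=> w w0w; rewrite /quadrant_rate_inv divr_ge0 ?mulr_ge0 ?phi_ge0//.
  by rewrite addr_ge0 ?sqr_ge0.
- apply/continuous_within_itvcyP; split.
    move=> w; rewrite in_itv/= andbT => w0w.
    exact: (ck _ (lt_trans w00 w0w)).
  exact: cvg_at_right_filter (ck _ w00).
- have cK : K x @[x --> (0 : R)] --> (0 : R).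
    rewrite -[X in _ --> X]K0.
    apply: differentiable_continuous; apply/derivable1_diffP.
    by have [] := dK 0 (ltrN10 _).
  rewrite -[X in _ --> X]oppr0; apply: cvgN.
  exact: (@cvg_comp _ _ _ (fun w : R => w^-1) K _ _ _ cvg_invy cK).
- by move=> w w0w; have [] := dF w (lt_trans w00 w0w).
- apply: cvg_at_right_filter; apply: differentiable_continuous.
  by apply/derivable1_diffP; have [] := dF w0 w00.
- move=> w; rewrite in_itv/= andbT => w0w.
  by have [_] := dF w (lt_trans w00 w0w); rewrite derive1E.
Qed.

End primitive.

Section cdf.
Local Open Scope classical_set_scope.
Local Open Scope ring_scope.
Context {R : realType}.
Implicit Types (x y z w a c s : R).
Local Notation mu := (@lebesgue_measure R).
Local Notation phi := (@gauss_pdf R).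
Local Notation cdf := (@gauss_cdf R).
Local Notation P := (@normal_prob R 0 1).

Lemma gauss_cdfE a : P `]-oo, a] = (cdf a)%:E.
Proof. by rewrite /gauss_cdf fineK// fin_num_measure. Qed.

Lemma tailE c : gauss_tail c = (1 - cdf c)%:E.
Proof.
rewrite EFinB -gauss_cdfE -probability_setC//.
rewrite setCitvl/= /gauss_tail -integral_itv_obnd_cbnd//.
by apply/measurable_EFinP; apply: measurable_funTS; exact: measurable_phi.
Qed.

Lemma tailN c : gauss_tail (- c) = (cdf c)%:E.
Proof.
rewrite -gauss_cdfE /normal_prob -[c in RHS]opprK ge0_integration_by_substitutionNy.
- by apply: eq_integral => x _; rewrite /= -/(gauss_pdf _) phiN.
- by apply: continuous_subspaceT; exact: continuous_phi.
- by move=> x _; exact: phi_ge0.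
Qed.

Lemma gauss_cdfN c : cdf (- c) = 1 - cdf c.
Proof. by apply: EFin_inj; rewrite -tailE -tailN opprK. Qed.

Lemma gauss_cdf_le x y : x <= y -> cdf x <= cdf y.
Proof.
move=> xy; rewrite -lee_fin -!gauss_cdfE; apply: le_measure; rewrite ?inE//.
exact: subitvPr.
Qed.

Lemma gauss_cdf_lt0 a : cdf a < 1 / 2 -> a < 0.
Proof.
move=> a2; rewrite ltNge; apply/negP => /gauss_cdf_le.
by have := gauss_cdfN 0; rewrite oppr0; lra.
Qed.

Lemma gauss_cdf_continuous : continuous cdf.
Proof.
move=> x; apply: differentiable_continuous; apply/derivable1_diffP.
have intf : mu.-integrable `]-oo, x + 1] (EFin \o phi).
  by apply: (integrableS _ _ (subsetT _)) => //; exact: integrable_normal_pdf.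
have xx : x < x + 1 by rewrite ltrDl.
by have [] := continuous_FTC1 xx intf (ltNyr _) (@continuous_phi R x).
Qed.

Lemma gauss_cdf_gt t : t < 1 -> exists x, t < cdf x.
Proof.
move=> t1.
have cv : P `]-oo, n%:R] @[n --> \oo] --> P (\bigcup_n [set` `]-oo, (n%:R : R)]]).
  apply: nondecreasing_cvg_mu => //; first exact: bigcup_measurable.
  move=> n m nm; apply/subsetPset => x/=; rewrite !in_itv/= => /le_trans.
  by apply; rewrite ler_nat.
have PT : P (\bigcup_n [set` `]-oo, (n%:R : R)]]) = 1%E.
  rewrite -(probability_setT P); congr P; rewrite -subTset => x _.
  by exists (Num.truncn x).+1; rewrite //= in_itv/= ltW// truncnS_gt.
rewrite PT in cv.
have /(cvgr_gt _)/(_ _ t1)[N _ HN] : cdf n%:R @[n --> \oo] --> (1 : R).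
  by apply: fine_cvg.
by exists N%:R; apply: (HN N) => /=.
Qed.

Lemma gauss_quantileK t : 0 < t < 1 -> cdf (gauss_quantile t) = t.
Proof.
move=> /andP[t0 t1].
suff [a _ ta] : exists2 a, a \in setT & cdf a = t.
  have /= := @xgetPex _ 0 [set x | cdf x = t] (ex_intro _ a ta); exact.
have [x tx] := gauss_cdf_gt t1.
have [y ty] : exists y, 1 - t < cdf y by apply: gauss_cdf_gt; lra.
have ty' : cdf (- y) < t by rewrite gauss_cdfN; lra.
have yx : - y <= x.
  by rewrite leNgt; apply/negP => /ltW/gauss_cdf_le; lra.
have [||a _ <-] := @IVT R cdf (- y) x t yx.
- by apply: continuous_subspaceT; exact: gauss_cdf_continuous.
- by rewrite ge_min le_max (ltW ty') (ltW tx) orbT.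
by exists a; rewrite ?inE.
Qed.

End cdf.

(** * The noise level as a function of the correlation *)

Section binormal.
Local Open Scope classical_set_scope.
Local Open Scope ring_scope.
Context {R : realType}.
Implicit Types (x y z w a c s : R).
Local Notation mu := (@lebesgue_measure R).
Local Notation phi := (@gauss_pdf R).
Local Notation cdf := (@gauss_cdf R).

Definition rho_of x : R := 2 * x / (1 + x ^+ 2).
(** The tangent of half the angle whose sine is [rho]; [rho_of] is its inverse. *)
Definition half_tan (rho : R) : R := rho / (1 + Num.sqrt (1 - rho ^+ 2)).

Lemma sqrt_rho_of x : 0 < x < 1 ->
  Num.sqrt (1 - rho_of x ^+ 2) = (1 - x ^+ 2) / (1 + x ^+ 2).
Proof.
move=> /andP[x0 x1].
have -> : 1 - rho_of x ^+ 2 = ((1 - x ^+ 2) / (1 + x ^+ 2)) ^+ 2.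
  by rewrite /rho_of; field; rewrite sq1_neq0.
rewrite sqrtr_sqr ger0_norm//; apply: divr_ge0.
  by rewrite subr_ge0 expr_le1// ltW.
by rewrite addr_ge0 ?sqr_ge0.
Qed.

Lemma rho_ofK x : 0 < x < 1 -> half_tan (rho_of x) = x.
Proof.
move=> x01; rewrite /half_tan sqrt_rho_of// /rho_of.
field; rewrite sq1_neq0 /=.
by rewrite (_ : _ + _ = 2) ?pnatr_eq0//; ring.
Qed.

Lemma rho_of_itv x : 0 < x < 1 -> 0 < rho_of x < 1.
Proof.
move=> /andP[x0 x1]; have p : 0 < 1 + x ^+ 2 by rewrite ltr_pwDl// sqr_ge0.
rewrite /rho_of divr_gt0 ?mulr_gt0//= ltr_pdivrMr// mul1r.
have : 0 < (1 - x) ^+ 2 by rewrite exprn_gt0// subr_gt0.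
rewrite (_ : (1 - x) ^+ 2 = 1 + x ^+ 2 - 2 * x); [lra | ring].
Qed.

Lemma half_tanP (rho : R) : 0 < rho < 1 ->
  [/\ 0 < half_tan rho, half_tan rho < 1, rho / 2 <= half_tan rho &
      rho_of (half_tan rho) = rho].
Proof.
move=> /andP[r0 r1]; rewrite /half_tan.
have d0 : 0 < 1 - rho ^+ 2 by rewrite subr_gt0 expr_lt1// ltW.
have k0 : 0 < Num.sqrt (1 - rho ^+ 2) by rewrite sqrtr_gt0.
have kk : Num.sqrt (1 - rho ^+ 2) ^+ 2 = 1 - rho ^+ 2 by rewrite sqr_sqrtr ?ltW.
move: (Num.sqrt _) k0 kk => k k0 kk.
have k1 : k < 1.
  by rewrite -(@ltr_pXn2r _ 2%N) ?nnegrE ?ltW// expr1n kk ltrBlDr ltrDl exprn_gt0.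
have k10 : 0 < 1 + k by lra.
split.
- by rewrite divr_gt0.
- by rewrite ltr_pdivrMr//; lra.
- by rewrite ler_pM2l// lef_pV2 ?posrE//; lra.
- have rr : rho ^+ 2 = (1 - k) * (1 + k) by move: kk; lra.
  rewrite /rho_of expr_div_n rr; field.
  have -> : 1 + k + (1 - k) = 2 by ring.
  by rewrite gt_eqF ?pnatr_eq0.
Qed.

Variables (a : R) (K : R -> R).
Hypothesis a0 : a < 0.
Hypothesis K0 : K 0 = 0.
Hypothesis dK : forall x, -1 < x -> is_derive x 1 K (quadrant_rate a x).

(** Conditionally on [W = y] the second coordinate is Gaussian with mean [k * y]
and standard deviation [c^-1], so the inner integral is a Gaussian tail. *)
Lemma binormal_prob_primitive (rho : R) : 0 < rho < 1 ->
  binormal_prob (Num.sqrt (1 - rho ^+ 2)) [set w | w.1 < a /\ w.2 > a] =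
  (K (half_tan rho))%:E.
Proof.
move=> r01; have [x0 x1 _ rE] := half_tanP r01.
move: (half_tan rho) x0 x1 rE => x x0 x1 rE.
rewrite -rE sqrt_rho_of ?x0//.
set k := _ / _.
rewrite -[x]invrK -(@integral_quadrant_rate_inv_primitive _ a _ K)// ?invr_gt0//.
rewrite -quadrant_rate_invE ?invr_gt0// /binormal_prob.
pose c := (1 + x ^+ 2) / (2 * x).
have c0 : 0 < c by apply: divr_gt0; [exact: sq1_gt0|exact: mulr_gt0].
have xN0 : x != 0 by rewrite gt_eqF.
have k2 : 1 - k ^+ 2 = c ^- 2.
  by rewrite /k /c; field; rewrite xN0 sq1_neq0.
pose f (z : R * R) := phi z.1 * (c * phi (c * z.2 + - (k * c) * z.1)).
have fE (z : R * R) : binormal_pdf k z = f z.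
  rewrite /binormal_pdf /f k2 -exprVn sqrtr_sqr ger0_norm ?invr_ge0 ?(ltW c0)//.
  rewrite !phiE invfM invrK -peak2.
  rewrite (_ : peak * expR _ * _ = peak ^+ 2 * c *
    (expR (- z.1 ^+ 2 / 2) * expR (- (c * z.2 + - (k * c) * z.1) ^+ 2 / 2)));
    last by ring.
  rewrite -expRD; congr (_ * expR _).
  have -> : - z.1 ^+ 2 / 2 + - (c * z.2 + - (k * c) * z.1) ^+ 2 / 2 =
      - (z.1 ^+ 2 * ((1 - k ^+ 2) * c ^+ 2) +
         c ^+ 2 * (z.2 ^+ 2 - 2 * k * z.1 * z.2 + k ^+ 2 * z.1 ^+ 2)) / 2.
    by rewrite k2 mulVf ?expf_neq0 ?gt_eqF//; field.
  by field; rewrite gt_eqF.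
have mfst : measurable_fun setT (fst : R * R -> R) by exact: measurable_fst.
have msnd : measurable_fun setT (snd : R * R -> R) by exact: measurable_snd.
have mh : measurable_fun setT
    (fun z : R * R => c * phi (c * z.2 + - (k * c) * z.1)).
  apply: measurable_funM => //; apply: (measurableT_comp measurable_phi).
  by apply: measurable_funD; apply: measurable_funM.
have mf : measurable_fun setT f.
  by apply: measurable_funM => //; exact: (measurableT_comp measurable_phi).
have -> : [set w : R * R | w.1 < a /\ w.2 > a] = `]-oo, a[ `*` `]a, +oo[.
  by apply/seteqP; split => -[y w]; rewrite /= !in_itv/= andbT.
under eq_integral do rewrite fE.
rewrite integral_rect//; last first.
  move=> y w _ _; apply: mulr_ge0; first exact: phi_ge0.
  by apply: mulr_ge0; [exact: ltW|exact: phi_ge0].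
apply: eq_integral => y _.
have mhy : measurable_fun setT (fun w => c * phi (c * w + - (k * c) * y)).
  exact: (@measurable_fun_pair2 _ _ _ _ _ _ _ y mh).
under eq_integral do rewrite /f/= EFinM.
rewrite ge0_integralZl_EFin ?phi_ge0//; first last.
- exact/measurable_EFinP/measurable_funTS.
- by move=> w _; rewrite lee_fin mulr_ge0 ?phi_ge0 ?(ltW c0).
congr (_ * _)%E.
rewrite integral_itv_obnd_cbnd; last exact/measurable_EFinP/measurable_funTS.
rewrite tail_affine//; congr gauss_tail.
by rewrite /threshold /c /k; field; rewrite xN0 sq1_neq0.
Qed.

(** At [x = 1] the correlation is 0 and the threshold is [a] whatever [y] is. *)
Lemma primitive1 : K 1 = cdf a * (1 - cdf a).
Proof.
apply: EFin_inj; rewrite -{1}invr1 -(@integral_quadrant_rate_inv_primitive _ a _ K)//.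
rewrite -quadrant_rate_invE//.
transitivity (\int[mu]_(y in `]-oo, a[) ((phi y)%:E * (1 - cdf a)%:E))%E.
  apply: eq_integral => y _; rewrite -tailE /threshold.
  by congr (_ * gauss_tail _)%E; field.
have mphi : measurable_fun `]-oo, a[ (EFin \o phi).
  by apply/measurable_EFinP; apply: measurable_funTS; exact: measurable_phi.
have c1 : 0 <= 1 - cdf a.
  by rewrite -lee_fin -tailE integral_ge0// => y _; rewrite lee_fin phi_ge0.
rewrite ge0_integralZr ?lee_fin//; last by move=> y _; rewrite lee_fin phi_ge0.
by rewrite EFinM -gauss_cdfE integral_itv_bndo_bndc.
Qed.

Lemma primitive_mvt x y : 0 <= x -> x <= y ->
  exists2 c, x <= c <= y & K y - K x = quadrant_rate a c * (y - x).
Proof.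
move=> x0 xy; have [||c] := @MVT_segment R K (quadrant_rate a) x y xy.
- by move=> z; rewrite in_itv/= => /andP[xz _]; apply: dK; lra.
- apply: derivable_within_continuous => z; rewrite in_itv/= => /andP[xz _].
  by have [] // := dK (_ : -1 < z); lra.
- by rewrite in_itv/= => cxy ->; exists c.
Qed.

Lemma quadrant_rate_gt0 z : 0 < quadrant_rate a z.
Proof.
rewrite /quadrant_rate divr_gt0 ?mulr_gt0 ?phi_gt0//.
by rewrite ltr_pwDl// sqr_ge0.
Qed.

Lemma primitive_lt x y : 0 <= x -> x < y -> K x < K y.
Proof.
move=> x0 xy; have [c _ e] := primitive_mvt x0 (ltW xy).
by rewrite -subr_gt0 e mulr_gt0 ?quadrant_rate_gt0// subr_gt0.
Qed.

(** Because [(x + t) ^+ 2 >= x ^+ 2 + t ^+ 2]. *)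
Lemma quadrant_rate_shift x t : 0 <= x -> 0 <= t ->
  quadrant_rate a (x + t) <= expR (- (a * x) ^+ 2 / 2) * quadrant_rate a t.
Proof.
move=> x0 t0; rewrite /quadrant_rate mulrA.
have xt : x ^+ 2 + t ^+ 2 <= (x + t) ^+ 2.
  have : 0 <= x * t by rewrite mulr_ge0.
  rewrite (_ : (x + t) ^+ 2 = x ^+ 2 + t ^+ 2 + 2 * (x * t)); [lra|ring].
have t1 s : 0 < 1 + s ^+ 2 by rewrite ltr_pwDl// sqr_ge0.
apply: ler_pM.
- by rewrite !mulr_ge0 ?phi_ge0.
- by rewrite invr_ge0 ltW.
- rewrite mulrCA ler_wpM2l ?mulr_ge0 ?phi_ge0//.
  rewrite !phiE mulrCA ler_pM2l ?peak_gt0// -expRD ler_expR.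
  rewrite -mulrDl ler_pM2r// -opprD lerN2 !exprMn -mulrDr.
  by rewrite ler_wpM2l// sqr_ge0.
- rewrite lef_pV2 ?posrE// lerD2l; apply: le_trans xt.
  by rewrite lerDr sqr_ge0.
Qed.

Lemma quadrant_rate_le z z' : 0 <= z -> z <= z' ->
  quadrant_rate a z' <= quadrant_rate a z.
Proof.
move=> z0 zz; have := @quadrant_rate_shift (z' - z) z; rewrite subrK subr_ge0.
move=> /(_ zz z0) /le_trans; apply.
rewrite ler_piMl ?(ltW (quadrant_rate_gt0 _))// -expR0 ler_expR.
by rewrite mulNr oppr_le0 divr_ge0// sqr_ge0.
Qed.

(** A primitive of a nonincreasing rate is concave, so it lies above its chord. *)
Lemma primitive_ge x : 0 <= x <= 1 -> x * K 1 <= K x.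
Proof.
move=> /andP[x0 x1].
have [c /andP[c0 cx] e] := primitive_mvt (lexx 0) x0.
have [d /andP[xd _] e'] := primitive_mvt x0 x1.
rewrite K0 !subr0 in e.
have cd := quadrant_rate_le c0 (le_trans cx xd).
have H : K 1 - K x <= quadrant_rate a c * (1 - x) by rewrite e' ler_wpM2r// subr_ge0.
have : x * (K 1 - K x) <= x * (quadrant_rate a c * (1 - x)) by rewrite ler_wpM2l.
rewrite e; lra.
Qed.

(** Integrated form of [quadrant_rate_shift]: compare the integral over [x, 1] with the
one over [0, 1 - x] by following their difference as the length grows. *)
Lemma primitive_shift x : 0 <= x <= 1 ->
  K 1 - K x <= expR (- (a * x) ^+ 2 / 2) * K 1.
Proof.
move=> /andP[x0 x1]; set e := expR _.
have x10 : 0 <= 1 - x by rewrite subr_ge0.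
pose L t := e * K t - K (x + t).
have dL (t : R) : 0 <= t ->
    is_derive t 1 L (e * quadrant_rate a t - quadrant_rate a (x + t)).
  move=> t0.
  have d1 : is_derive t 1 K (quadrant_rate a t) by apply: dK; lra.
  have d2 : is_derive (x + t) 1 K (quadrant_rate a (x + t)) by apply: dK; lra.
  have d3 : is_derive t 1 (fun t => x + t) 1.
    by apply: is_derive_eq; rewrite add0r mulr1.
  have d4 : is_derive t 1 (K \o (fun t => x + t)) (quadrant_rate a (x + t) * 1).
    exact: is_derive1_comp.
  rewrite mulr1 in d4.
  have d5 : is_derive t 1 (fun t => e * K t) (e * quadrant_rate a t).
    by apply: is_derive_eq; rewrite /GRing.scale/=; ring.
  exact: is_deriveB.
have [||c] := @MVT_segment R L
  (fun t => e * quadrant_rate a t - quadrant_rate a (x + t)) 0 (1 - x) x10.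
- by move=> t; rewrite in_itv/= => /andP[/ltW t0 _]; exact: dL.
- apply: derivable_within_continuous => t; rewrite in_itv/= => /andP[t0 _].
  by have [] := dL t t0.
rewrite in_itv/= => /andP[c0 _] H.
have : 0 <= L (1 - x) - L 0.
  by rewrite H subr0 mulr_ge0// subr_ge0 quadrant_rate_shift.
have xx1 : x + (1 - x) = 1 by ring.
rewrite /L K0 mulr0 addr0 xx1 => H1.
have : e * K (1 - x) <= e * K 1.
  rewrite ler_pM2l ?expR_gt0//.
  have : 1 - x <= 1 by lra.
  rewrite le_eqVlt => /predU1P[->//|h]; exact/ltW/primitive_lt.
lra.
Qed.

Lemma primitive1_bounds : phi a ^+ 2 <= K 1 <= phi a.
Proof.
have [c /andP[c0 c1]] := primitive_mvt (lexx 0) ler01.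
rewrite K0 !subr0 mulr1 => ->; apply/andP; split.
  apply: le_trans (quadrant_rate_le c0 c1).
  have -> // : quadrant_rate a 1 = phi a ^+ 2.
  by rewrite /quadrant_rate mulr1 expr1n -[1 + 1]/(2 : R); field.
apply: (le_trans (quadrant_rate_le (lexx 0) c0)).
rewrite /quadrant_rate mulr0 expr0n addr0 divr1 mulrAC ler_piMl ?phi_ge0//.
have -> : phi 0 = peak by rewrite phiE expr0n oppr0 mul0r expR0 mulr1.
rewrite -(@ler_pXn2r _ 2%N)// ?nnegrE ?mulr_ge0 ?(ltW peak_gt0)//.
rewrite exprMn peak2 expr1n ler_pdivrMr ?mulr_gt0 ?pi_gt0// mul1r.
have := pi_ge2 R; lra.
Qed.

End binormal.

(** * Comparison of the two noise scales *)

Section noise_correspondence.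
Context {R : realType}.
Implicit Types (x y z w a c s : R).
Local Notation phi := (@gauss_pdf R).
Local Notation cdf := (@gauss_cdf R).

(** The identity [primitive1] turns this isoperimetric-type bound into an upper
bound for the integrand. *)
Lemma gauss_variance_le a : a < 0 -> cdf a * (1 - cdf a) <= phi a.
Proof.
move=> a0; have [K [K0 dK]] := primitive_exists (@continuous_quadrant_rate R a).
by rewrite -(primitive1 a0 K0 dK); have /andP[] := primitive1_bounds K0 dK.
Qed.

Lemma gauss_h_ge0 (t : R) : 0 <= gauss_h t.
Proof. by rewrite /gauss_h; case: ifP => // _; exact: phi_ge0. Qed.

(** The quantile of [1 - p] is positive, but its opposite has distribution
function [p], and [phi] is even. *)
Lemma gauss_h_ge (p : R) : 0 < p < 1 / 2 ->
  bitvar p <= gauss_h p /\ bitvar p <= gauss_h (1 - p).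
Proof.
move=> /andP[p0 p2]; have p01 : 0 < p < 1 by rewrite p0; lra.
have q01 : 0 < 1 - p < 1 by apply/andP; split; lra.
rewrite /gauss_h p01 q01 /bitvar.
have ap := gauss_quantileK p01; have aq := gauss_quantileK q01.
split.
  by rewrite -{1 2}ap gauss_variance_le// gauss_cdf_lt0// ap.
have aq' : cdf (- gauss_quantile (1 - p)) = p by rewrite gauss_cdfN aq subKr.
by rewrite -[gauss_pdf _]phiN -{1 2}aq' gauss_variance_le// gauss_cdf_lt0// aq'.
Qed.

Lemma two_pi_le : 2 * pi <= expR 3 :> R.
Proof.
have e1 : 2 <= expR 1 :> R by have := expR_ge1Dx (1 : R); lra.
have -> : expR 3 = expR 1 * expR 1 * expR 1 :> R.
  by rewrite -!expRD; congr expR; ring.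
have p4 : pi <= 4 :> R by have /andP[_] := pihalf_02 R; lra.
have : 4 <= expR 1 * expR 1 :> R by nra.
nra.
Qed.

Lemma ln_variance_ge a (v : R) : phi a ^+ 2 <= v -> - (a ^+ 2 + 3) <= ln v.
Proof.
move=> av; have v0 : 0 < v by apply: lt_le_trans av; rewrite exprn_gt0 ?phi_gt0.
rewrite -ler_expR lnK ?posrE//; apply: le_trans av.
rewrite phiE exprMn peak2 opprD expRD -expRM_natl.
have -> : 2%:R * (- a ^+ 2 / 2) = - a ^+ 2 by field.
rewrite mulrC ler_wpM2r ?expR_ge0// expRN lef_pV2 ?posrE ?expR_gt0 ?mulr_gt0 ?pi_gt0//.
exact: two_pi_le.
Qed.

(** Multiplying the two bounds on [q] bounds [q ^+ 2] by
[exp (- x ^+ 2 * (1 + a ^+ 2 / 2))]; as [x ^+ 2 >= rho ^+ 2 / 4] and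
[- ln v <= a ^+ 2 + 3], the exponent 4 / 96 = 1 / 24 satisfies
[(a ^+ 2 + 3) / 24 <= 1 / 8 + a ^+ 2 / 16]. *)
Lemma decay_exponent a (v rho x q : R) : phi a ^+ 2 <= v ->
  0 < rho -> rho / 2 <= x -> x <= 1 -> 0 <= q -> q <= 1 - x ->
  q <= expR (- (a * x) ^+ 2 / 2) ->
  q <= (v ^+ 4) `^ (rho ^+ 2 / 96).
Proof.
move=> av r0 rx x1 q0 q1 q2.
have v0 : 0 < v by apply: lt_le_trans av; rewrite exprn_gt0 ?phi_gt0.
have x0 : 0 <= x by lra.
have xx : rho ^+ 2 / 4 <= x ^+ 2.
  rewrite (_ : rho ^+ 2 / 4 = (rho / 2) ^+ 2); last by field.
  by rewrite lerXn2r ?nnegrE//; lra.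
have {}q1 : q <= expR (- x ^+ 2).
  apply: (le_trans q1); apply: (@le_trans _ _ (expR (- x))).
    exact: expR_ge1Dx.
  rewrite ler_expR lerN2 expr2; nra.
have q_le : q <= expR (- (x ^+ 2 * (1 + a ^+ 2 / 2)) / 2).
  rewrite -(@ler_pXn2r _ 2%N)// ?nnegrE ?expR_ge0//.
  have -> : expR (- (x ^+ 2 * (1 + a ^+ 2 / 2)) / 2) ^+ 2 =
      expR (- x ^+ 2) * expR (- (a * x) ^+ 2 / 2).
    by rewrite -expRM_natl -expRD; congr expR; field.
  by rewrite expr2 ler_pM.
apply: (le_trans q_le).
rewrite /powR gt_eqF ?exprn_gt0// ler_expR lnXn//.
have lnv := ln_variance_ge av.
have r2 : 0 <= rho ^+ 2 by exact: sqr_ge0.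
have a2 : 0 <= a ^+ 2 by exact: sqr_ge0.
rewrite -[ln v *+ 4]mulr_natl.
have h1 : rho ^+ 2 / 96 * (4 * - (a ^+ 2 + 3)) <= rho ^+ 2 / 96 * (4 * ln v).
  by rewrite ler_wpM2l ?divr_ge0// ler_wpM2l.
apply: le_trans h1.
have h2 : rho ^+ 2 / 4 * (1 + a ^+ 2 / 2) <= x ^+ 2 * (1 + a ^+ 2 / 2).
  by rewrite ler_wpM2r//; lra.
have h3 : 0 <= rho ^+ 2 * a ^+ 2 by rewrite mulr_ge0.
lra.
Qed.

End noise_correspondence.

Theorem theorem5p4 (R : realType) :
  exists C1 C2 : R, [/\ 0 < C1, 0 < C2 &
    forall alpha : R, 0 < alpha < 1 / 2 ->
    forall (n : nat) (A : {set cube n}) (eta : R),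
      (1 <= n)%N -> 0 < eta < 1 ->
      (exists! rho : R, noise_param alpha eta rho) /\
      (forall rho : R, noise_param alpha eta rho ->
        VAR alpha A eta
          <= C1 * (\sum_(i < n) (h_influence gauss_h alpha A i) ^+ 2)
                  `^ (C2 * rho ^+ 2))].
Proof.
(* 192 = 2 * 96: [VAR_le] halves the exponent given by [decay_exponent] *)
exists 2, 192^-1; split=> // p p2 n A eta _ /andP[e0 e1].
have /andP[p0 plt2] := p2.
have p01 : 0 < p < 1 by rewrite p0; lra.
set a := gauss_quantile p.
have ap : gauss_cdf a = p := gauss_quantileK p01.
have a0 : a < 0 by rewrite gauss_cdf_lt0// ap.
have [K [K0 dK]] := primitive_exists (@continuous_quadrant_rate R a).
have K1 : K 1 = bitvar p by rewrite (primitive1 a0 K0 dK) ap.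
have v0 : 0 < bitvar p by exact: bitvar_gt0.
have Klt := primitive_lt dK.
have npE rho : 0 < rho < 1 ->
    noise_param p eta rho <-> eta = K (half_tan rho) / bitvar p.
  move=> r01; rewrite /noise_param -/a (binormal_prob_primitive a0 K0 dK r01)/=.
  by split=> [[]|].
split.
  have [x x01 Kx] : exists2 x, x \in `[0, 1] & K x = eta * bitvar p.
    apply: IVT => //.
      apply: derivable_within_continuous => z; rewrite in_itv/= => /andP[z0 _].
      by have [] // := dK z (_ : -1 < z); lra.
    have K01 := ltW (Klt 0 1 (lexx _) ltr01).
    rewrite (min_l K01) (max_r K01) K0 K1 mulr_ge0 ?(ltW e0) ?(ltW v0)//=.
    by rewrite ler_piMl ?(ltW e1) ?(ltW v0).
  have {}x01 : 0 < x < 1.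
    move: x01; rewrite in_itv/= !le_eqVlt => /andP[/predU1P[x0|->]].
      move: Kx; rewrite -x0 K0 => e0v; have := mulr_gt0 e0 v0.
      by rewrite -e0v ltxx.
    move=> /predU1P[x1|->//].
    move: Kx; rewrite x1 K1 -[X in X = _]mul1r => /(mulIf (lt0r_neq0 v0)) e1'.
    by rewrite -e1' ltxx in e1.
  exists (rho_of x); split.
    by apply/npE; [exact: rho_of_itv|rewrite rho_ofK// Kx mulfK ?gt_eqF].
  move=> rho np; have r01 : 0 < rho < 1 by have [] := np.
  have [y0 y1 _ yE] := half_tanP r01.
  move/(npE _ r01): np => eE; rewrite -yE; congr rho_of.
  have {}eE : K (half_tan rho) = K x by rewrite Kx eE mulfVK ?gt_eqF.
  have /andP[x0 _] := x01.
  have [h|h|//] := ltgtP x (half_tan rho).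
    by have := Klt _ _ (ltW x0) h; rewrite eE ltxx.
  by have := Klt _ _ (ltW y0) h; rewrite eE ltxx.
move=> rho np; have r01 : 0 < rho < 1 by have [] := np.
have [x0 x1 rx _] := half_tanP r01.
move/(npE _ r01): np => eE.
have /andP[r0 r1] := r01.
have [h1 h2] := gauss_h_ge p2.
have -> : 192^-1 * rho ^+ 2 = rho ^+ 2 / 96 / 2 by field.
have xI : 0 <= half_tan rho <= 1 by rewrite !ltW.
apply: VAR_le => //; [exact: gauss_h_ge0|exact: ltW| |].
  rewrite divr_gt0 ?exprn_gt0//= ler_pdivrMr// mul1r.
  by have : rho ^+ 2 <= 1; [rewrite exprn_ile1 ?ltW//|lra].
have v_lb : gauss_pdf a ^+ 2 <= bitvar p.
  by rewrite -K1; have /andP[] := primitive1_bounds K0 dK.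
apply: (decay_exponent v_lb r0 rx); [exact: ltW|by rewrite subr_ge0 ltW| |].
  rewrite lerD2l lerN2 eE ler_pdivlMr// -K1.
  exact: (primitive_ge K0 dK).
rewrite eE -(ler_pM2r v0) mulrBl mul1r mulfVK ?gt_eqF// -K1.
exact: (primitive_shift K0 dK).
Qed.
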